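(* The set $\mathcal H_X$ is at most countable, and for all $Q\in\mathcal B$ the function $(0,1)\setminus\mathcal H_Q\ni\alpha\mapsto\mathcal H^{\alpha,0}(\Lambda,\phi_0)(Q)$ is continuously differentiable (that is, $(0,1)\ni\alpha\mapsto\mathcal H^{\alpha,0}(\Lambda,\phi_0)(Q)$ is differentiable at every point of $(0,1)\setminus\mathcal H_Q$ and the derivative is continuous as a function on $(0,1)\setminus\mathcal H_Q$).
   Context: Setting. Let $X$ be a set, $S:X\to X$ a bijection, $\mathcal A$ a $\sigma$-algebra on $X$, $\mathcal A_0$ the $\sigma$-algebra generated by $\bigcup_{i\ge 0}S^{-i}\mathcal A$, $\mathcal B$ the $\sigma$-algebra generated by $\bigcup_{i\in\mathbb Z}S^{-i}\mathcal A$, and $\mathcal A_m:=S^{-m}\mathcal A_0=\{S^{-m}A:A\in\mathcal A_0\}$ for integers $m\le 0$ (so $\mathcal A_0\subset\mathcal A_{-1}\subset\cdots$). Let $\phi_0$ be a finite positive measure on $\mathcal A_0$, and $\Lambda$ a finite positive measure on $\mathcal A_0$ with $\Lambda\circ S^{-1}=\Lambda$ and $\Lambda\ll\phi_0$; let $Z\ge0$ be an $\mathcal A_0$-measurable version of $d\Lambda/d\phi_0$. For $Q\subset X$ let $\mathcal C(Q)$ be the set of all sequences $(A_m)_{m\le0}$ with $A_m\in\mathcal A_m$ for all $m\le 0$ and $Q\subset\bigcup_{m\le0}A_m$. Define $\Phi(Q):=\inf_{(A_m)\in\mathcal C(Q)}\sum_{m\le0}\phi_0(S^mA_m)$. The symbol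 $\Lambda$ also denotes $\Lambda(Q):=\inf_{(A_m)\in\mathcal C(Q)}\sum_{m\le0}\Lambda(S^mA_m)$, $Q\subset X$; its restriction to $\mathcal B$ is the unique $S$-invariant measure on $\mathcal B$ extending $\Lambda$. Conventions: extended real numbers are used, $0\log0:=0$, $y^x:=e^{x\log y}$ and thus $0^0:=1$; $Z^\alpha\log Z:=0$ where $Z=0$ ($\alpha>0$). For $\epsilon>0$ and $\alpha\in[0,1]$: $\mathcal C^0_\epsilon(Q):=\{(A_m)\in\mathcal C(Q):\sum_{m\le0}\phi_0(S^mA_m)<\Phi(Q)+\epsilon\}$; $\mathcal H^{\alpha,0}(\Lambda,\phi_0)(Q):=\lim_{\epsilon\to0}\inf_{(A_m)\in\mathcal C^0_\epsilon(Q)}\sum_{m\le0}\int_{S^mA_m}Z^\alpha d\phi_0$, which is a finite $S$-invariant measure on $\mathcal B$. For $Q\in\mathcal B$: $\mathcal C^{\alpha}_{1,\epsilon}(Q):=\{(A_m)\in\mathcal C^0_\epsilon(Q):\sum_{m\le0}\int_{S^mA_m}Z^\alpha d\phi_0<\mathcal H^{\alpha,0}(\Lambda,\phi_0)(Q)+\epsilon\}$; for $0<\alpha<1$: $\Psi^{\alpha,\alpha}_1(Q):=\lim_{\epsilon\to0}\inf_{(A_m)\in\mathcal C^{\alpha}_{1,\epsilon}(Q)}\sum_{m\le0}\int_{S^mA_m}Z^\alpha\log Z\,d\phi_0$. Let $\mathcal C^1_\epsilon(Q):=\{(A_m)\in\mathcal C(Q):\sum_{m\le0}\Lambda(S^mA_m)<\Lambda(Q)+\epsilon\}$;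 $\mathcal C^{0,1}_\epsilon(Q):=\{(A_m)\in\mathcal C^1_\epsilon(Q):\sum_{m\le0}\phi_0(S^mA_m)<\Phi^{\Lambda}(Q)+\epsilon\}$, where $\Phi^{\Lambda}(Q):=\lim_{\epsilon\to0}\inf_{(A_m)\in\mathcal C^1_\epsilon(Q)}\sum_{m\le0}\phi_0(S^mA_m)$ (which equals $\Phi(Q)$); $\mathcal H^{\alpha,0,1}(\Lambda,\phi_0)(Q):=\lim_{\epsilon\to0}\inf_{(A_m)\in\mathcal C^{0,1}_\epsilon(Q)}\sum_{m\le0}\int_{S^mA_m}Z^\alpha d\phi_0$ and $\mathcal C^{\alpha,0,1}_\epsilon(Q):=\{(A_m)\in\mathcal C^{0,1}_\epsilon(Q):\sum_{m\le0}\int_{S^mA_m}Z^\alpha d\phi_0<\mathcal H^{\alpha,0,1}(\Lambda,\phi_0)(Q)+\epsilon\}$. For $0<\alpha<1$: $\Xi^{\alpha,\alpha}_1(Q):=\lim_{\epsilon\to0}\sup_{(A_m)\in\mathcal C^{\alpha,0,1}_\epsilon(Q)}\sum_{m\le0}\int_{S^mA_m}Z^\alpha\log Z\,d\phi_0$. For $Q\in\mathcal B$: $\mathcal H_Q:=\{\alpha\in(0,1):\ \Psi^{\alpha,\alpha}_1(Q)<\Xi^{\alpha,\alpha}_1(Q)\}$ (and $\mathcal H_X$ is the case $Q=X$). *)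

(* Defs.v *)
From HB Require Import structures.
From mathcomp Require Import all_boot all_order all_algebra.
From mathcomp Require Import all_classical all_reals all_analysis.
From mathcomp Require Import measurable_realfun.

Set Implicit Arguments.
Unset Strict Implicit.
Unset Printing Implicit Defensive.

Import Order.TTheory GRing.Theory Num.Theory.
Import numFieldNormedType.Exports.

Local Open Scope classical_set_scope.
Local Open Scope ring_scope.
Local Open Scope ereal_scope.

(* A nonpositive time m is encoded by the natural number n = - m.  For a      *)
(* bijection S, the set S^m B is the preimage of B under the n-th iterate of  *)
(* S, and S^(-m) B is its image.  X is pointed because measurable types are.  *)
Section Sigma_algebras.
Variables (X : pointedType) (S : X -> X) (A : set (set X)).

Definition past_sets : set (set X) :=
  \bigcup_n [set iter n S @^-1` B | B in A].

Definition A0 : set (set X) := <<s past_sets >>.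

Definition all_time_sets : set (set X) :=
  \bigcup_n ([set iter n S @^-1` B | B in A] `|` [set iter n S @` B | B in A]).

Definition Bfull : set (set X) := <<s all_time_sets >>.

(* The sigma-algebra A_(-n) = S^n A_0. *)
Definition Aneg (n : nat) : set (set X) := [set iter n S @` B | B in A0].

(* F n stands for the member A_(-n) of a covering sequence of Q. *)
Definition covers (Q : set X) : set (nat -> set X) :=
  [set F | (forall n, Aneg n (F n)) /\ Q `<=` \bigcup_n F n].

End Sigma_algebras.

Notation A0T S A := (g_sigma_algebraType (past_sets S A)).

Section Set_functions.
Variables (R : realType) (X : pointedType) (S : X -> X) (A : set (set X)).

(* The sum over m <= 0 of g (S^m A_m). *)
Definition pull_sum (g : set X -> \bar R) (F : nat -> set X) : \bar R :=
  \sum_(0 <= n <oo) g (iter n S @^-1` F n).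

Definition outer (g : set X -> \bar R) (Q : set X) : \bar R :=
  ereal_inf [set pull_sum g F | F in covers S A Q].

Definition lim_inf_over (C : R -> set (nat -> set X)) (g : set X -> \bar R) :
    \bar R :=
  lim (ereal_inf [set pull_sum g F | F in C e] @[e --> (0:R)^'+]).

Definition lim_sup_over (C : R -> set (nat -> set X)) (g : set X -> \bar R) :
    \bar R :=
  lim (ereal_sup [set pull_sum g F | F in C e] @[e --> (0:R)^'+]).

(* The sequences of C whose g-sum exceeds the value v by less than e. *)
Definition nearly_optimal (C : set (nat -> set X)) (g : set X -> \bar R)
    (v : \bar R) (e : R) : set (nat -> set X) :=
  [set F | C F /\ pull_sum g F < v + e%:E].

Variables (phi0 Lambda : {finite_measure set (A0T S A) -> \bar R}).
Variable Z : A0T S A -> \bar R.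

Definition pow_int (a : R) (E : set X) : \bar R :=
  \int[phi0]_(x in (E : set (A0T S A))) (Z x `^ a).

(* Where Z = 0 and a > 0, the integrand is 0 * -oo, which is 0 in \bar R. *)
Definition pow_log_int (a : R) (E : set X) : \bar R :=
  \int[phi0]_(x in (E : set (A0T S A))) (Z x `^ a * lne (Z x)).

(* C^0_e(Q) *)
Definition cov0 (Q : set X) (e : R) : set (nat -> set X) :=
  nearly_optimal (covers S A Q) phi0 (outer phi0 Q) e.

(* H^(a,0)(Lambda, phi_0)(Q) *)
Definition hellinger0 (a : R) (Q : set X) : \bar R :=
  lim_inf_over (cov0 Q) (pow_int a).

(* C^a_(1,e)(Q) *)
Definition cov_a1 (a : R) (Q : set X) (e : R) : set (nat -> set X) :=
  nearly_optimal (cov0 Q e) (pow_int a) (hellinger0 a Q) e.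

(* Psi^(a,a)_1(Q) *)
Definition Psi1 (a : R) (Q : set X) : \bar R :=
  lim_inf_over (cov_a1 a Q) (pow_log_int a).

(* C^1_e(Q) *)
Definition cov1 (Q : set X) (e : R) : set (nat -> set X) :=
  nearly_optimal (covers S A Q) Lambda (outer Lambda Q) e.

(* Phi^Lambda(Q) *)
Definition Phi_Lambda (Q : set X) : \bar R := lim_inf_over (cov1 Q) phi0.

(* C^(0,1)_e(Q) *)
Definition cov01 (Q : set X) (e : R) : set (nat -> set X) :=
  nearly_optimal (cov1 Q e) phi0 (Phi_Lambda Q) e.

(* H^(a,0,1)(Lambda, phi_0)(Q) *)
Definition hellinger01 (a : R) (Q : set X) : \bar R :=
  lim_inf_over (cov01 Q) (pow_int a).

(* C^(a,0,1)_e(Q) *)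
Definition cov_a01 (a : R) (Q : set X) (e : R) : set (nat -> set X) :=
  nearly_optimal (cov01 Q e) (pow_int a) (hellinger01 a Q) e.

(* Xi^(a,a)_1(Q) *)
Definition Xi1 (a : R) (Q : set X) : \bar R :=
  lim_sup_over (cov_a01 a Q) (pow_log_int a).

(* The set H_Q of exponents. *)
Definition HQ (Q : set X) : set R :=
  [set a | (0 < a < 1)%R /\ Psi1 a Q < Xi1 a Q].

End Set_functions.

(* Main.v *)
Require Import Defs.
From HB Require Import structures.
From mathcomp Require Import all_boot all_order all_algebra.
From mathcomp Require Import all_classical all_reals all_analysis.
From mathcomp Require Import measurable_realfun.
From mathcomp Require Import ring lra.

(* For a cover F = (A_m) put I_f(F) = sum_m int_{S^m A_m} f dphi_0.  Along a
   fixed cover, a |-> I_{Z^a}(F) is convex, and on [e, 1 - e] its second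
   derivative is at most C_e (I_1(F) + I_Z(F)).  The Hellinger function H is the
   limiting infimum of these functions over nearly phi_0-optimal covers, and
   disjoint covers have I_Z(F) <= Lambda(X), so H is semiconcave.  Psi_1(a) and
   Xi_1(a) are limits of the slopes I_{Z^a ln Z}(F) along nearly minimising
   covers; hence m = Psi_1(a) and m = Xi_1(a) both satisfy
     H(b) <= H(a) + m (b - a) + C (b - a)^2.
   Such slopes at points a < b satisfy m_b - 2 C b <= m_a - 2 C a, so the
   intervals (Psi_1(a) - 2 C a, Xi_1(a) - 2 C a) are disjoint, and only countably
   many are nonempty.  Convexity along covers that are nearly minimal at b gives
   H(b) >= H(a) + (Psi_1(a) - o(1)) (b - a) for b > a, and the same with Xi_1
   for b < a; so H'(a) exists as soon as Xi_1(a) <= Psi_1(a), and its continuity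
   follows from the supergradient inequality.

   Since Xi_1 only sees covers that are also nearly optimal for Lambda, one needs
   covers that are nearly optimal for phi_0, Z^a phi_0 and Lambda at once.  They
   are the nearly optimal covers for phi_0 + s Z^a phi_0 + Lambda with s small,
   because the outer measure of g + Lambda is the sum of the outer measures of g
   and of Lambda on the full sigma-algebra. *)

Set Implicit Arguments.
Unset Strict Implicit.
Unset Printing Implicit Defensive.

Import Order.TTheory GRing.Theory Num.Theory.
Import numFieldNormedType.Exports.

Local Open Scope classical_set_scope.
Local Open Scope ring_scope.

(** * Semiconcave functions on the unit interval *)

Section two_supergradients.
Variables (R : realType) (f p q C : R -> R).

(** [C] depends on the distance [d] to the end points: near the exponents 0 and 1 the second
    derivative of a |-> z^a is not bounded by a fixed multiple of 1 + z. *)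
Definition quad_supergradient (m : R -> R) := forall d a b : R,
  0 < d -> d <= a <= 1 - d -> d <= b <= 1 - d ->
  f b <= f a + m a * (b - a) + C d * (b - a) ^+ 2.

Hypothesis C_ge0 : forall d, 0 < d -> 0 <= C d.
Hypothesis supp : quad_supergradient p.
Hypothesis supq : quad_supergradient q.
(** Combined with [supp] and [supq], these one-sided bounds say that [p] is the right derivative and
    [q] the left derivative of [f]. *)
Hypothesis lowp : forall a eta, 0 < a < 1 -> 0 < eta -> exists2 r, 0 < r &
  forall b, b < 1 -> a < b < a + r -> f a + (p a - eta) * (b - a) <= f b.
Hypothesis lowq : forall a eta, 0 < a < 1 -> 0 < eta -> exists2 r, 0 < r &
  forall b, 0 < b -> a - r < b < a -> f a + (q a + eta) * (b - a) <= f b.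

Let margin (a : R) := Num.min a (1 - a) / 2.

Let margin_gt0 a : 0 < a < 1 -> 0 < margin a.
Proof. by move=> /andP[a0 a1]; rewrite divr_gt0// lt_min a0 subr_gt0. Qed.

Let margin_itv a b : 0 < a < 1 -> `|b - a| <= margin a ->
  margin a <= b <= 1 - margin a.
Proof.
move=> /andP[a0 a1]; rewrite /margin ler_norml => /andP[].
have [] : Num.min a (1 - a) <= a /\ Num.min a (1 - a) <= 1 - a.
  by split; rewrite ge_min lexx ?orbT.
set m := Num.min _ _ => ? ? ? ?; apply/andP; split; lra.
Qed.

(** Adding the bound from [a] to [b] with slope [p a] and the bound from [b] to [a] with slope [q b]
    cancels [f]. In other words, p - 2 C x and q - 2 C x are supergradients of the concave function
    f - C x^2, and such slopes decrease. *)
Lemma supergradient_gap d a b : 0 < d -> d <= a <= 1 - d -> d <= b <= 1 - d ->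
  a < b -> q b - 2 * C d * b <= p a - 2 * C d * a.
Proof.
move=> d0 ha hb ab.
have h1 := supp d0 ha hb; have h2 := supq d0 hb ha.
have ba0 : 0 < b - a by rewrite subr_gt0.
suff : (q b - p a - 2 * C d * (b - a)) * (b - a) <= 0.
  by rewrite pmulr_lle0//; lra.
by move: h1 h2; rewrite !expr2; nra.
Qed.

Lemma countable_supergradient_jumps :
  countable [set a | 0 < a < 1 /\ p a < q a].
Proof.
(* The constant [C d] is fixed only away from the end points, so (0, 1) is exhausted by the
   intervals [1/(n+2), 1 - 1/(n+2)]. *)
pose J n := [set a : R | n.+2%:R^-1 <= a <= 1 - n.+2%:R^-1 /\ p a < q a].
apply: (@sub_countable _ _ _ (\bigcup_n J n)); last first.
  apply: bigcup_countable => // n _.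
  have d0 : 0 < n.+2%:R^-1 :> R by rewrite invr_gt0.
  set d := n.+2%:R^-1 in d0 *; pose K := 2 * C d.
  (* By [supergradient_gap] a rational chosen in each of these intervals strictly decreases with
     [a], so the choice is injective. *)
  have pick a : exists r : rat, J n a -> p a - K * a < ratr r < q a - K * a.
    have [Ja|] := pselect (J n a); last by exists 0.
    have /rat_in_itvoo[r hr] : p a - K * a < q a - K * a.
      by rewrite ltrD2r; case: Ja.
    by exists r => _; move: hr; rewrite in_itv.
  have [g hg] := choice pick.
  suff : {in J n &, injective g}.
    move=> gi; apply/countable_injP; exists (pickle \o g) => x y xJ yJ /=.
    by move=> /(pcan_inj pickleK); exact: gi.
  have key a b : J n a -> J n b -> a < b -> ratr (g b) < ratr (g a) :> R.
    move=> Ja Jb ab.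
    have /andP[_ hb] := hg b Jb; have /andP[ha _] := hg a Ja.
    have := supergradient_gap d0 (proj1 Ja) (proj1 Jb) ab; rewrite -/K => h.
    exact: lt_trans hb (le_lt_trans h ha).
  move=> a b; rewrite !inE => Ja Jb gab.
  have [ab|ab|//] := ltgtP a b.
  - by have := key _ _ Ja Jb ab; rewrite gab ltxx.
  - by have := key _ _ Jb Ja ab; rewrite gab ltxx.
apply: subset_card_le => a [a01 pq].
pose n := Num.truncn ((margin a)^-1); exists n => //; split=> //.
have m0 := margin_gt0 a01.
have nm : n.+2%:R^-1 <= margin a.
  rewrite -[leRHS]invrK lef_pV2 ?posrE ?invr_gt0//.
  rewrite (le_trans (ltW (truncnS_gt _)))//.
  by rewrite ler_nat.
have /andP[m1 m2] : margin a <= a <= 1 - margin a.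
  by apply: margin_itv => //; rewrite subrr normr0 ltW.
by rewrite (le_trans nm m1)/= (le_trans m2)// lerD2l lerN2.
Qed.

(** At a - h, [supp] bounds [f] from above and [lowq] bounds it from below; dividing by h > 0 and
    letting h tend to 0 compares the two slopes. *)
Lemma supergradient_le a : 0 < a < 1 -> p a <= q a.
Proof.
move=> a01; apply/ler_addgt0Pr => e e0.
have e20 : 0 < e / 2 by rewrite divr_gt0.
have [r r0 hr] := lowq a01 e20.
have m0 := margin_gt0 a01; set m := margin a in m0.
have C0 := C_ge0 m0.
pose h := Num.min (r / 2) (Num.min m (e / 2 / (C m + 1))).
have C1 : 0 < C m + 1 by rewrite ltr_wpDl.
have h0 : 0 < h by rewrite !lt_min m0 !divr_gt0.
have hC : (C m + 1) * h <= e / 2.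
  by rewrite mulrC -ler_pdivlMr// !ge_min lexx !orbT.
have hr2 : h <= r / 2 by rewrite ge_min lexx.
have hm : h <= m by rewrite !ge_min lexx orbT.
have ma : `|a - a| <= m by rewrite subrr normr0 ltW.
have mh : `|(a - h) - a| <= m by rewrite addrAC subrr add0r normrN gtr0_norm.
have hb : m <= a - h <= 1 - m := margin_itv a01 mh.
have h1 := supp m0 (margin_itv a01 ma) hb.
have /hr/(_ _)/le_trans/(_ h1) : 0 < a - h.
  by case/andP: hb => + _; exact: lt_le_trans.
have -> : a - h - a = - h by ring.
have -> : a - r < a - h < a by apply/andP; split; lra.
move=> /(_ isT); rewrite expr2 => h2.
suff : (p a - q a - e / 2 - C m * h) * h <= 0 by rewrite pmulr_lle0//; lra.
lra.
Qed.

Lemma supergradient_expansion a eta : 0 < a < 1 -> q a <= p a -> 0 < eta ->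
  exists2 r, 0 < r & forall b, `|b - a| < r ->
    `|f b - f a - p a * (b - a)| <= eta * `|b - a|.
Proof.
move=> a01 qp eta0.
have pq : q a = p a by apply/eqP; rewrite eq_le qp supergradient_le.
have [r1 r10 hr1] := lowp a01 eta0; have [r2 r20 hr2] := lowq a01 eta0.
have m0 := margin_gt0 a01; set m := margin a in m0.
have C0 := C_ge0 m0; have C1 : 0 < C m + 1 by rewrite ltr_wpDl.
have ma : `|a - a| <= m by rewrite subrr normr0 ltW.
pose r := Num.min r1 (Num.min r2 (Num.min m (eta / (C m + 1)))).
have r0 : 0 < r by rewrite !lt_min r10 r20 m0 divr_gt0.
have [rr1 rr2 rm rC] : [/\ r <= r1, r <= r2, r <= m & r <= eta / (C m + 1)].
  by split; rewrite !ge_min lexx ?orbT.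
exists r => // b br.
have hb : m <= b <= 1 - m := margin_itv a01 (le_trans (ltW br) rm).
have b01 : 0 < b < 1 by case/andP: hb => ? ?; apply/andP; split; lra.
have h1 := supp m0 (margin_itv a01 ma) hb.
have hC : (C m + 1) * `|b - a| <= eta.
  by rewrite mulrC -ler_pdivlMr// (le_trans (ltW br)).
rewrite ler_norml; apply/andP; split.
- move: br; have [ab|ab|<-] := ltgtP a b; last first.
  + by rewrite !subrr mulr0 normr0 mulr0 !subrr oppr0.
  + rewrite ltr0_norm ?subr_lt0// => br.
    by have := hr2 b ltac:(lra) ltac:(lra); rewrite pq; lra.
  + rewrite gtr0_norm ?subr_gt0// => br.
    by have := hr1 b ltac:(lra) ltac:(lra); lra.
- have : C m * (b - a) ^+ 2 <= eta * `|b - a|.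
    rewrite -real_normK ?num_real// expr2 mulrA ler_wpM2r//.
    by rewrite (le_trans _ hC)// ler_wpM2r// lerDl.
  lra.
Qed.

Lemma is_derive_supergradient a : 0 < a < 1 -> q a <= p a ->
  is_derive a 1 f (p a).
Proof.
move=> a01 qp.
suff h : (fun h => h^-1 *: ((f \o shift a) (h *: (1 : R)) - f a)) @ 0^' --> p a.
  by apply: DeriveDef; [apply/cvg_ex; exists (p a) | exact/cvg_lim].
apply/cvgrPdist_le => e e0; have [r r0 hr] := supergradient_expansion a01 qp e0.
near=> h; rewrite /=.
have h0 : h != 0 by near: h; exact: nbhs_dnbhs_neq.
have hn : 0 < `|h| by rewrite normr_gt0.
have := hr (h + a); rewrite addrK => /(_ _).
rewrite /GRing.scale/= mulr1 => {}hr.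
have {}hr : `|f (h + a) - f a - p a * h| <= e * `|h|.
  by apply: hr; near: h; apply: dnbhs0_lt.
rewrite -(ler_pM2r hn) (le_trans _ hr)// -normrM mulrBl mulrAC mulVf// mul1r.
by rewrite distrC.
Unshelve. all: by end_near.
Qed.

(** The slopes are compared through the test points g = a - s and g = a + s, with |b - a| < s/2. The
    supergradient at [b] bounds f g - f b from above and the expansion at [a] bounds it from below;
    the two signs of g - b give the two inequalities. *)
Lemma supergradient_continuous a eta : 0 < a < 1 -> q a <= p a -> 0 < eta ->
  exists2 r, 0 < r & forall b, `|b - a| < r -> `|p a - p b| <= eta.
Proof.
move=> a01 qp eta0; have eta60 : 0 < eta / 6 by rewrite divr_gt0.
have [r r0 hr] := supergradient_expansion a01 qp eta60.
have m0 := margin_gt0 a01; set m := margin a in m0.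
have C0 := C_ge0 m0; have C1 : 0 < C m + 1 by rewrite ltr_wpDl.
pose s := Num.min (r / 2) (Num.min (m / 2) (eta / 4 / (C m + 1))).
have s0 : 0 < s.
  by rewrite !lt_min; apply/and3P; split; rewrite divr_gt0// divr_gt0.
have [sr sm sC] : [/\ s <= r / 2, s <= m / 2 & s <= eta / 4 / (C m + 1)].
  by split; rewrite !ge_min lexx ?orbT.
have {}sC : C m * s <= eta / 4.
  by have := sC; rewrite ler_pdivlMr//; lra.
exists (s / 2); rewrite ?divr_gt0// => b bs.
have bm : `|b - a| <= m by lra.
have hb := hr b ltac:(lra).
have step g : `|g - a| = s -> p b * (g - b) >= p a * (g - b) - eta * `|g - b|.
  move=> gs.
  have hg := hr g ltac:(lra).
  have := supp m0 (margin_itv a01 bm) (margin_itv a01 (_ : `|g - a| <= m)).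
  move=> /(_ ltac:(lra)); rewrite -[(g - b) ^+ 2]real_normK ?num_real//.
  have g1 := ler_distD a g b; rewrite (distrC a) in g1.
  have g2 := ler_distD b g a.
  rewrite gs in g1 g2 hg; move: hb hg; rewrite !ler_norml.
  move=> /andP[_ hb] /andP[hg _] hsup.
  have : C m * `|g - b| ^+ 2 <= eta / 2 * `|g - b|.
    rewrite expr2 mulrA ler_wpM2r//.
    rewrite (le_trans (y := C m * (s * 2)))//; last by lra.
    by rewrite ler_wpM2l//; lra.
  (* Since |g - b| > s/2 > |b - a|, the two expansion errors add up to at most (eta/2) |g - b|; the
     quadratic term takes the other half of eta. *)
  have : eta / 6 * (s + `|b - a|) <= eta / 6 * (3 * `|g - b|).
    by rewrite ler_wpM2l ?ltW//; lra.
  lra.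
have /ler_normlP[b1 b2] := ltW bs.
rewrite ler_norml; apply/andP; split.
- have := step (a - s); rewrite addrAC subrr add0r normrN gtr0_norm// => /(_ erefl).
  have bg : 0 < b - (a - s) by lra.
  rewrite distrC gtr0_norm// => h.
  by rewrite -(ler_pM2r bg); lra.
- have := step (a + s); rewrite addrAC subrr add0r gtr0_norm// => /(_ erefl).
  have bg : 0 < (a + s) - b by lra.
  rewrite gtr0_norm// => h.
  by rewrite -(ler_pM2r bg); lra.
Qed.

Lemma supergradient_C1 (E : set R) :
  (forall a, E a -> 0 < a < 1 /\ q a <= p a) ->
  (forall a, E a -> derivable f a 1) /\ {within E, continuous (derive1 f)}.
Proof.
move=> EP; split=> [a /EP[a01 qp]|].
  by have [] := is_derive_supergradient a01 qp.
have derivE a : E a -> derive1 f a = p a.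
  by move=> /EP[a01 qp]; rewrite derive1E; have [] := is_derive_supergradient a01 qp.
apply/subspace_continuousP => a Ea.
have [a01 qp] := EP a Ea.
suff : derive1 f x @[x --> within E (nbhs a)] --> p a by rewrite -(derivE a Ea).
apply/cvgrPdist_le => e e0.
have [r r0 hr] := supergradient_continuous a01 qp e0.
rewrite near_withinE; near=> b; move=> Eb; have -> := derivE b Eb.
by apply: hr; rewrite distrC; near: b; exact: (@cvgr_dist_lt _ _ _ (nbhs a) _ id).
Unshelve. all: by end_near.
Qed.

End two_supergradients.

(** * Limiting infima of a family of convex functions *)

Section value_of_a_convex_family.
(** In the application [G] consists of covers of Q; [N], [L], [h a] and [d a] are their sums for
    phi_0, Lambda, Z^a phi_0 and Z^a ln Z phi_0. [P] and [L0] are the outer measures of Q for phi_0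
    and Lambda, [M] is Lambda(X), [H] is the Hellinger function, and [p], [q] are Psi_1 and Xi_1. *)
Variables (R : realType) (T : Type) (G : set T) (N L : T -> R) (h d : R -> T -> R).
Variables (K K1 : R -> R) (P L0 M : R) (H p q : R -> R).

Hypothesis K_ge0 : forall e, 0 < e -> 0 <= K e.
Hypothesis N_ge0 : forall F, G F -> 0 <= N F.
Hypothesis L_ge0 : forall F, G F -> 0 <= L F.
Hypothesis h_convex : forall F a b, G F -> 0 < a < 1 -> 0 < b < 1 ->
  h a F + d a F * (b - a) <= h b F.
Hypothesis h_semiconcave : forall F e a b, G F -> 0 < e ->
  e <= a <= 1 - e -> e <= b <= 1 - e ->
  h b F <= h a F + d a F * (b - a) + K e * (b - a) ^+ 2 * (N F + L F).
Hypothesis d_bound : forall F a, G F -> 0 < a < 1 ->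
  `|d a F| <= K1 a * (N F + L F).

Definition near_min a e F := [/\ G F, N F < P + e & h a F < H a + e].

Hypothesis H_low : forall a k, 0 < a < 1 -> 0 < k -> exists2 e, 0 < e &
  forall F, G F -> N F < P + e -> H a - k < h a F.
Hypothesis H_up : forall a e, 0 < a < 1 -> 0 < e -> exists2 F,
  near_min a e F & L F < L0 + e.
Hypothesis p_low : forall a k, 0 < a < 1 -> 0 < k -> exists2 e, 0 < e &
  forall F, near_min a e F -> p a - k < d a F.
Hypothesis p_up : forall a k e, 0 < a < 1 -> 0 < k -> 0 < e -> exists F,
  [/\ near_min a e F, L F <= M & d a F < p a + k].
Hypothesis q_up : forall a k, 0 < a < 1 -> 0 < k -> exists2 e, 0 < e &
  forall F, near_min a e F -> L F < L0 + e -> d a F < q a + k.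
Hypothesis q_low : forall a k e, 0 < a < 1 -> 0 < k -> 0 < e -> exists F,
  [/\ near_min a e F, L F < L0 + e & q a - k < d a F].

(** A common bound for N + L on both kinds of near-minimising covers with error at most 1: those
    realising [p] satisfy L F <= M, those realising [q] satisfy L F < L0 + e. *)
Let B := P + 1 + Num.max M (L0 + 1).
Let C e := K e * B.

Let mass_le F a e : e <= 1 -> near_min a e F -> L F <= M \/ L F < L0 + e ->
  N F + L F <= B.
Proof.
move=> e1 [_ NF _] LF; rewrite /B lerD//; first by lra.
by rewrite le_max; case: LF => [->//|?]; apply/orP; right; lra.
Qed.

Let near_min_le a e e' F : e <= e' -> near_min a e F -> near_min a e' F.
Proof. by move=> ee' [GF NF hF]; split=> //; lra. Qed.

Let itv01 (a e : R) : 0 < e -> e <= a <= 1 - e -> 0 < a < 1.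
Proof. by move=> e0 /andP[? ?]; apply/andP; split; lra. Qed.

Let B_ge0 : 0 <= B.
Proof.
have h01 : 0 < (2^-1 : R) < 1 by apply/andP; split; lra.
have [F NF LF] := H_up h01 ltr01.
by apply: le_trans (mass_le (lexx 1) NF (or_intror LF)); case: NF => GF _ _;
  rewrite addr_ge0 ?N_ge0 ?L_ge0.
Qed.

(** Near-optimality for phi_0 does not involve the exponent. Hence a cover that is nearly minimal at
    [a] still competes at [b], where [H_low] gives H b <= h b F up to a small error, and the
    semiconcavity of h along F does the rest. *)
Lemma supergradient_of_near_min (m : R -> R) :
  (forall a k e, 0 < a < 1 -> 0 < k -> 0 < e -> exists F,
    [/\ near_min a e F, L F <= M \/ L F < L0 + e & `|d a F - m a| <= k]) ->
  quad_supergradient H C m.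
Proof.
move=> mP e a b e0 ha hb; apply/ler_addgt0Pr => k k0.
have k30 : 0 < k / 3 by lra.
have [a01 b01] := (itv01 e0 ha, itv01 e0 hb).
have [e1 e10 he1] := H_low b01 k30.
pose e2 := Num.min 1 (Num.min e1 (k / 3)).
have e20 : 0 < e2 by rewrite !lt_min ltr01 e10 k30.
have [e21 e2e1 e2k] : [/\ e2 <= 1, e2 <= e1 & e2 <= k / 3].
  by split; rewrite !ge_min lexx ?orbT.
have [F [nF LF dF]] := mP a (k / 3) e2 a01 k30 e20.
have NLB := mass_le e21 nF LF; case: nF => GF NF hF.
have h1 := he1 F GF (lt_le_trans NF _); have {h1} := h1 ltac:(lra).
have := h_semiconcave GF e0 ha hb.
have : K e * (b - a) ^+ 2 * (N F + L F) <= C e * (b - a) ^+ 2.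
  by rewrite /C mulrAC ler_wpM2r ?sqr_ge0// ler_wpM2l ?K_ge0.
have : (d a F - m a) * (b - a) <= k / 3.
  rewrite (le_trans (ler_norm _))// normrM -[leRHS]mulr1 ler_pM//.
  by rewrite ler_norml; lra.
lra.
Qed.

Let supp : quad_supergradient H C p.
Proof.
apply: supergradient_of_near_min => a k e a01 k0 e0.
have [e1 e10 he1] := p_low a01 k0.
have e20 : 0 < Num.min e e1 by rewrite lt_min e0.
have [F [nF LF dF]] := p_up a01 k0 e20; exists F; split.
- by apply: near_min_le nF; rewrite ge_min lexx.
- by left.
- have : p a - k < d a F by apply/he1/(near_min_le _ nF); rewrite ge_min lexx orbT.
  by rewrite ler_norml; lra.
Qed.

Let supq : quad_supergradient H C q.
Proof.
apply: supergradient_of_near_min => a k e a01 k0 e0.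
have [e1 e10 he1] := q_up a01 k0.
have e20 : 0 < Num.min e e1 by rewrite lt_min e0.
have [F [nF LF dF]] := q_low a01 k0 e20; exists F.
have [me me1] : Num.min e e1 <= e /\ Num.min e e1 <= e1.
  by split; rewrite ge_min lexx ?orbT.
split.
- exact: near_min_le nF.
- by right; lra.
- have : d a F < q a + k.
    by apply: he1; [exact: near_min_le nF | lra].
  by rewrite ler_norml; lra.
Qed.

(** Covers nearly minimal at [b] are nearly minimal at [a] when [b] is close: h a F exceeds h b F,
    and H b exceeds H a, by at most O(|b - a|). The radius [r] is independent of the accuracy [k] at
    [b], so [k] can tend to 0 with [b] fixed. *)
Let near_min_perturb a e : 0 < a < 1 -> 0 < e -> exists2 r, 0 < r &
  forall b k, 0 < b < 1 -> `|b - a| < r -> 0 < k -> exists F,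
    [/\ near_min a e F, L F < L0 + e, H a - k < h a F & h b F < H b + k].
Proof.
move=> a01 e0; pose m := Num.min a (1 - a) / 2.
have [ma1 ma2] : Num.min a (1 - a) <= a /\ Num.min a (1 - a) <= 1 - a.
  by split; rewrite ge_min lexx ?orbT.
have m0 : 0 < m by rewrite divr_gt0// lt_min; lra.
have C0 : 0 <= C m by rewrite mulr_ge0// K_ge0.
(* The sum of the Lipschitz constant of h at [a] along the cover and that of the upper bound of H at
   [a], plus 1 for positivity. *)
pose D := `|K1 a| * B + `|p a| + C m + 1.
have D0 : 0 < D by rewrite ltr_wpDl// !addr_ge0// mulr_ge0.
pose r := Num.min 1 (Num.min m (e / 2 / D)).
have r0 : 0 < r by rewrite !lt_min ltr01 m0 !divr_gt0.
have [r1 rm rD] : [/\ r <= 1, r <= m & r <= e / 2 / D].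
  by split; rewrite !ge_min lexx ?orbT.
exists r => // b k b01 br k0.
have [e1 e10 he1] := H_low a01 k0.
pose e2 := Num.min 1 (Num.min e1 (Num.min k (e / 2))).
have e20 : 0 < e2 by rewrite !lt_min ltr01 e10 k0 divr_gt0.
have [e21 e2e1 e2k e2e] : [/\ e2 <= 1, e2 <= e1, e2 <= k & e2 <= e / 2].
  by split; rewrite !ge_min lexx ?orbT.
have [F nF LF] := H_up b01 e20.
have NLB := mass_le e21 nF (or_intror LF); case: nF => GF NF hF.
have hab : h a F <= h b F + `|K1 a| * B * `|b - a|.
  have := h_convex GF a01 b01.
  suff : - (d a F * (b - a)) <= `|K1 a| * B * `|b - a| by lra.
  rewrite (le_trans (ler_norm _))// normrN normrM ler_wpM2r//.
  rewrite (le_trans (d_bound GF a01))//.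
  rewrite (le_trans (ler_norm _))// normrM ler_wpM2l// ger0_norm//.
  by rewrite addr_ge0 ?N_ge0 ?L_ge0.
have hHb : H b <= H a + (`|p a| + C m) * `|b - a|.
  have hbm : m <= b <= 1 - m.
    by have := le_trans (ltW br) rm; rewrite ler_norml /m => ?; apply/andP; split; lra.
  have ham : m <= a <= 1 - m by rewrite /m; apply/andP; split; lra.
  have := supp m0 ham hbm.
  have : p a * (b - a) <= `|p a| * `|b - a| by rewrite -normrM ler_norm.
  have : C m * (b - a) ^+ 2 <= C m * `|b - a|.
    rewrite ler_wpM2l// -real_normK ?num_real// expr2 ler_piMr//.
    by rewrite (le_trans (ltW br)).
  lra.
have : D * `|b - a| <= e / 2.
  by rewrite mulrC -ler_pdivlMr// (le_trans (ltW br)).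
have ba0 : 0 <= `|b - a| by [].
rewrite /D => hD.
exists F; split; [split=> //; lra|lra| |lra].
by apply: he1 => //; lra.
Qed.

(** A cover nearly minimal at [b] is nearly minimal at [a] too, so its slope at [a] exceeds p a -
    eta, and convexity along it bounds H b from below. *)
Let lowp a eta : 0 < a < 1 -> 0 < eta -> exists2 r, 0 < r &
  forall b, b < 1 -> a < b < a + r -> H a + (p a - eta) * (b - a) <= H b.
Proof.
move=> a01 eta0; have [e e0 he] := p_low a01 eta0.
have [r r0 hr] := near_min_perturb a01 e0; exists r => // b b1 ab.
apply/ler_addgt0Pr => k k0; have k20 : 0 < k / 2 by lra.
have b01 : 0 < b < 1 by lra.
have [F [nF LF hF1 hF2]] := hr b (k / 2) b01 ltac:(rewrite ltr_norml; lra) k20.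
have dF := he F nF; case: nF => GF _ _.
have := h_convex GF a01 b01.
have : (p a - eta) * (b - a) <= d a F * (b - a).
  by rewrite ler_wpM2r//; lra.
lra.
Qed.

(** For b < a the sign of b - a calls for an upper bound on the slope. [q_up] gives it only for
    covers nearly optimal for Lambda, which is why [near_min_perturb] controls L F. *)
Let lowq a eta : 0 < a < 1 -> 0 < eta -> exists2 r, 0 < r &
  forall b, 0 < b -> a - r < b < a -> H a + (q a + eta) * (b - a) <= H b.
Proof.
move=> a01 eta0; have [e e0 he] := q_up a01 eta0.
have [r r0 hr] := near_min_perturb a01 e0; exists r => // b b1 ab.
apply/ler_addgt0Pr => k k0; have k20 : 0 < k / 2 by lra.
have b01 : 0 < b < 1 by lra.
have [F [nF LF hF1 hF2]] := hr b (k / 2) b01 ltac:(rewrite ltr_norml; lra) k20.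
have dF := he F nF LF; case: nF => GF _ _.
have := h_convex GF a01 b01.
have : (q a + eta) * (b - a) <= d a F * (b - a).
  by rewrite ler_wnM2r//; lra.
lra.
Qed.

Let C_ge0 e : 0 < e -> 0 <= C e.
Proof. by move=> e0; rewrite mulr_ge0// K_ge0. Qed.

Lemma countable_value_jumps : countable [set a | 0 < a < 1 /\ p a < q a].
Proof. exact: (countable_supergradient_jumps supp supq). Qed.

Lemma value_C1 (E : set R) : (forall a, E a -> 0 < a < 1 /\ q a <= p a) ->
  (forall a, E a -> derivable H a 1) /\ {within E, continuous (derive1 H)}.
Proof. by move=> EP; have := supergradient_C1 C_ge0 supp lowp lowq EP. Qed.

End value_of_a_convex_family.

(** * Second-order expansion of powers in the exponent *)

Section power_inequalities.
Variable R : realType.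
Implicit Types z a b e : R.

Lemma powR_expR_shift z a b : 0 < z -> z `^ b = z `^ a * expR ((b - a) * ln z).
Proof.
move=> z0; rewrite -{1}(subrK a b) addrC powRD; last by rewrite (gt_eqF z0) implybT.
by rewrite [in X in _ * X]/powR (gt_eqF z0).
Qed.

(** This is e^u >= 1 + u with u = (b - a) ln z. The exponent a = 0 is excluded because of 0^0 =
    1. *)
Lemma powR_expansion_ge z a b : 0 <= z -> a != 0 ->
  z `^ a + z `^ a * ln z * (b - a) <= z `^ b.
Proof.
rewrite le_eqVlt => /predU1P[<- a0|z0 _].
  by rewrite powR0// !mul0r addr0 powR_ge0.
rewrite (powR_expR_shift a b z0).
have : z `^ a * (1 + (b - a) * ln z) <= z `^ a * expR ((b - a) * ln z).
  by rewrite ler_wpM2l ?powR_ge0// expR_ge1Dx.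
lra.
Qed.

Lemma powR_le1D z a : 0 <= z -> 0 <= a <= 1 -> z `^ a <= 1 + z.
Proof.
move=> z0 /andP[a0 a1]; have [z1|z1] := leP z 1.
  move: z0; rewrite le_eqVlt => /predU1P[<-|z0].
    by rewrite /powR eqxx addr0 lern1 leq_b1.
  have : z `^ a <= z `^ 0 by apply: ger_powR; rewrite ?z0.
  by rewrite powRr0; lra.
have : z `^ a <= z `^ 1 by apply: ler_powR; rewrite ?(ltW z1).
by rewrite powRr1//; lra.
Qed.

(** The inequality x^2 <= e^(2x), applied to x = e |ln z| / 2, trades the squared logarithm for z^e
    + z^(-e). After multiplication by z^a the exponents a + e and a - e still lie in [0, 1], where
    z^c <= 1 + z. *)
Lemma ln_sqr_powR_le z a e : 0 <= z -> 0 < e -> e <= a <= 1 - e ->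
  z `^ a * ln z ^+ 2 <= 8 / e ^+ 2 * (1 + z).
Proof.
rewrite le_eqVlt => /predU1P[<- e0 ea|z0 e0 /andP[ea ae]].
  by rewrite powR0 ?mul0r ?addr0 ?mulr1 ?divr_ge0 ?sqr_ge0//; apply: lt0r_neq0; lra.
have ez : (e * ln z / 2) ^+ 2 <= z `^ e + z `^ (- e).
  have key (x : R) : 0 <= x -> x ^+ 2 <= expR (2 * x).
    move=> x0; rewrite mulr_natl mulr2n expRD -expr2 lerXn2r ?nnegrE ?expR_ge0//.
    by rewrite (le_trans _ (expR_ge1Dx x))// lerDr.
  have [l0|l0] := leP 0 (ln z).
    have := key (e * ln z / 2); rewrite divr_ge0 ?mulr_ge0 ?(ltW e0)// => /(_ isT).
    have -> : 2 * (e * ln z / 2) = e * ln z by lra.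
    move=> /le_trans; apply.
    by rewrite /powR (gt_eqF z0) lerDl expR_ge0.
  have l1 : 0 <= - (e * ln z / 2).
    by rewrite -mulNr -mulrN divr_ge0// mulr_ge0 ?(ltW e0)// oppr_ge0 ltW.
  have := key _ l1; rewrite sqrrN => /le_trans; apply.
  have -> : 2 * - (e * ln z / 2) = - e * ln z by lra.
  by rewrite /powR (gt_eqF z0) lerDr expR_ge0.
have {}ez : ln z ^+ 2 <= 4 / e ^+ 2 * (z `^ e + z `^ (- e)).
  rewrite mulrAC ler_pdivlMr ?exprn_gt0//.
  by move: ez; rewrite !expr2; lra.
have e2 : 0 <= 4 / e ^+ 2 by rewrite divr_ge0 ?sqr_ge0.
have -> : 8 / e ^+ 2 * (1 + z) = 4 / e ^+ 2 * (2 * (1 + z)) by lra.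
rewrite (le_trans (ler_wpM2l (powR_ge0 z a) ez))//.
rewrite mulrCA ler_wpM2l// mulrDr -!powRD ?(gt_eqF z0) ?implybT//.
by rewrite mulrDl mul1r lerD// powR_le1D ?(ltW z0)//; apply/andP; split; lra.
Qed.

Lemma powR_expansion_le z a b e : 0 <= z -> 0 < e -> e <= a <= 1 - e ->
  e <= b <= 1 - e ->
  z `^ b <= z `^ a + z `^ a * ln z * (b - a) +
            16 / e ^+ 2 * (b - a) ^+ 2 * (1 + z).
Proof.
rewrite le_eqVlt => /predU1P[<- e0 ea eb|z0 e0 ea eb].
  have [a0 b0] : a != 0 /\ b != 0 by split; apply: lt0r_neq0; lra.
  by rewrite !powR0// !mul0r !add0r addr0 mulr1 mulr_ge0 ?divr_ge0 ?sqr_ge0.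
have zba := powR_expR_shift a b z0.
set u := (b - a) * ln z in zba.
(* This form of the remainder is chosen because z^a (1 + e^u) = z^a + z^b, so that [ln_sqr_powR_le]
   applies at both exponents. *)
have u1 : expR u - 1 - u <= u ^+ 2 * (1 + expR u).
  have E0 : 0 <= u ^+ 2 * expR u by rewrite mulr_ge0 ?sqr_ge0 ?expR_ge0.
  have u2 := sqr_ge0 u.
  have : expR u * (1 - u) <= 1.
    by rewrite -[leRHS](expRxMexpNx_1 u) ler_wpM2l ?expR_ge0 ?expR_ge1Dx.
  have [u0|u0] := leP 0 u => h; move: E0 u2; rewrite expr2 => E0 u2.
    by have := ler_wpM2l u0 h; lra.
  have nu : 0 <= - u by lra.
  by have := ler_wpM2l nu (expR_ge1Dx u); lra.
have := ln_sqr_powR_le (ltW z0) e0 ea; have := ln_sqr_powR_le (ltW z0) e0 eb.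
set A := 8 / _ => hb ha; have -> : 16 / e ^+ 2 = 2 * A by rewrite /A; lra.
have : z `^ a * (expR u - 1 - u) <= z `^ a * (u ^+ 2 * (1 + expR u)).
  by rewrite ler_wpM2l ?powR_ge0.
have -> : z `^ a * (u ^+ 2 * (1 + expR u)) =
    (b - a) ^+ 2 * (z `^ a * ln z ^+ 2 + z `^ b * ln z ^+ 2).
  by rewrite zba /u; ring.
have : (b - a) ^+ 2 * (z `^ a * ln z ^+ 2 + z `^ b * ln z ^+ 2) <=
    (b - a) ^+ 2 * (A * (1 + z) + A * (1 + z)).
  by rewrite ler_wpM2l ?sqr_ge0// lerD.
by rewrite zba /u; lra.
Qed.

(** The tangent inequality at [a], evaluated at the exponent 0; the exponent 1 gives the upper bound
    in [norm_powR_ln_le]. *)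
Lemma powR_ln_ge z a : 0 <= z -> 0 < a -> - a^-1 <= z `^ a * ln z.
Proof.
move=> z0 a0; have := powR_expansion_ge 0 z0 (lt0r_neq0 a0).
rewrite powRr0 sub0r => h.
rewrite -(ler_pM2r a0) mulNr mulVf ?gt_eqF//.
by have := powR_ge0 z a; lra.
Qed.

Lemma norm_powR_ln_le z a : 0 <= z -> 0 < a < 1 ->
  `|z `^ a * ln z| <= (a^-1 + (1 - a)^-1) * (1 + z).
Proof.
move=> z0 /andP[a0 a1]; rewrite ler_norml; apply/andP; split.
  have := powR_ln_ge z0 a0.
  have : 0 <= a^-1 by rewrite invr_ge0 ltW.
  have : 0 <= (1 - a)^-1 by rewrite invr_ge0 subr_ge0 ltW.
  nra.
have := powR_expansion_ge 1 z0 (lt0r_neq0 a0); rewrite powRr1// => h.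
have a1' : 0 < 1 - a by rewrite subr_gt0.
have : z `^ a * ln z <= (1 - a)^-1 * (1 + z).
  rewrite ler_pdivlMl//.
  by have := powR_ge0 z a; lra.
have : 0 <= a^-1 * (1 + z) by rewrite mulr_ge0 ?invr_ge0 ?addr_ge0 // ltW.
by lra.
Qed.

End power_inequalities.

(** * Outer measures of covering sequences *)

Section covering_sequences.
Variables (R : realType) (X : pointedType) (S : X -> X) (A : set (set X)).
Hypothesis bijS : bijective S.
Local Notation T := (A0T S A).
Local Notation mA0 := (@measurable _ T).
Local Open Scope ereal_scope.
Implicit Types (F : nat -> set X) (Q B : set X) (m : {measure set T -> \bar R}).

Lemma iter_bij n : bijective (iter n S).
Proof.
by elim: n => [|n ih]; [exists id | exact: (bij_comp bijS ih)].
Qed.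

Lemma measurable_shift B : mA0 B -> mA0 (S @^-1` B).
Proof.
have mS : measurable_fun setT (S : T -> T).
  apply: (@measurability _ _ T T setT S (past_sets S A) erefl).
  move=> _ [_ [n _ [C AC <-]] <-]; rewrite setTI.
  apply: sub_sigma_algebra; exists n.+1 => //; exists C => //.
  by apply/seteqP; split=> x /=; rewrite -iterSr.
by move=> mB; rewrite -[_ @^-1` _]setTI; exact: mS.
Qed.

Lemma measurable_iter_shift n B : mA0 B -> mA0 (iter n S @^-1` B).
Proof.
by elim: n B => [//|n ih] B mB; exact: (ih _ (measurable_shift mB)).
Qed.

Lemma AnegP n Q : Aneg S A n Q <-> mA0 (iter n S @^-1` Q).
Proof.
have [g fg gf] := iter_bij n; split=> [[B mB <-]|mQ].
  rewrite (_ : _ @^-1` _ = B)//; apply/seteqP; split=> x /=.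
    by move=> [y By /(can_inj fg) <-].
  by move=> Bx; exists x.
exists (iter n S @^-1` Q) => //; apply/seteqP; split=> x /=.
  by move=> [y Qy <-].
by move=> Qx; exists (g x); rewrite /= gf.
Qed.

Lemma coversP Q F : covers S A Q F <->
  (forall n, mA0 (iter n S @^-1` F n)) /\ Q `<=` \bigcup_n F n.
Proof.
by split=> -[h1 h2]; split=> // n; [exact: (AnegP _ _).1 | exact: (AnegP _ _).2].
Qed.

Lemma measurable_Aneg_leq n k Q : (n <= k)%N -> mA0 (iter n S @^-1` Q) ->
  mA0 (iter k S @^-1` Q).
Proof.
move=> nk mQ; rewrite -(subnK nk) addnC.
have -> : iter (n + (k - n)) S @^-1` Q = iter (k - n) S @^-1` (iter n S @^-1` Q).
  by apply/seteqP; split=> x /=; rewrite iterD.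
exact: measurable_iter_shift.
Qed.

Lemma pull_sum_ge0 m F : 0 <= pull_sum S m F.
Proof. by apply: nneseries_ge0 => n _ _; exact: measure_ge0. Qed.

Lemma outer_ge0 m Q : 0 <= outer S A m Q.
Proof.
by apply: le_ereal_inf_tmp => _ [F _ <-]; exact: pull_sum_ge0.
Qed.

Lemma outer_le m Q F : covers S A Q F -> outer S A m Q <= pull_sum S m F.
Proof. by move=> QF; apply: ereal_inf_lbound; exists F. Qed.

Lemma covers_cst B : mA0 B -> covers S A B (fun n => if n is 0%N then B else set0).
Proof.
move=> mB; apply/coversP; split=> [[//|n]|x Bx]; last by exists 0%N.
by rewrite preimage_set0; exact: measurable0.
Qed.

Lemma pull_sum_cst m B :
  pull_sum S m (fun n => if n is 0%N then B else set0) = m B.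
Proof.
rewrite /pull_sum nneseries_recl//.
rewrite [X in _ + X]eseries0; first by rewrite adde0.
by move=> [//|n] _ _; rewrite preimage_set0 measure0.
Qed.

Lemma outer_le_measure m B : mA0 B -> outer S A m B <= m B.
Proof. by move=> mB; rewrite -pull_sum_cst; exact/outer_le/covers_cst. Qed.

Lemma outer_set0 m : outer S A m set0 = 0.
Proof.
apply/eqP; rewrite eq_le outer_ge0 andbT.
by rewrite (le_trans (outer_le_measure m measurable0))// measure0.
Qed.

Lemma le_outer m Q Q' : Q `<=` Q' -> outer S A m Q <= outer S A m Q'.
Proof.
move=> QQ'; apply: le_ereal_inf_tmp => _ [F [AF Q'F] <-]; apply: outer_le.
by split=> //; exact: subset_trans Q'F.
Qed.

Lemma outer_fin m Q : fin_num_fun m -> outer S A m Q \is a fin_num.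
Proof.
move=> fm; rewrite ge0_fin_numE ?outer_ge0//.
rewrite (le_lt_trans (le_outer m (@subsetT _ Q)))//.
rewrite (le_lt_trans (outer_le_measure m measurableT))//.
by rewrite ltey_eq fm//; exact: measurableT.
Qed.

(** The near-optimal covers of the sets [Q k] are merged index by index, since the n-th member must
    stay in A_(-n); no re-enumeration of pairs takes place. *)
Lemma outer_sigma_subadditive m : fin_num_fun m -> sigma_subadditive (outer S A m).
Proof.
move=> fm Q; apply/lee_addgt0Pr => e e0.
have [F PF] : {F : nat -> nat -> set X & forall k, covers S A (Q k) (F k) /\
    pull_sum S m (F k) <= outer S A m (Q k) + (e / (2 ^ k.+1)%:R)%:E}.
  apply: (@choice _ _ (fun k F => covers S A (Q k) F /\
    pull_sum S m F <= outer S A m (Q k) + (e / (2 ^ k.+1)%:R)%:E)) => k.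
  have ek : (0 < e / (2 ^ k.+1)%:R)%R by rewrite divr_gt0// ltr0n expn_gt0.
  have [_ [F QF <-] /ltW hF] := lb_ereal_inf_adherent ek (outer_fin (Q k) fm).
  by exists F.
rewrite (le_trans _ (epsilon_trick _ _ (ltW e0)))//; last first.
  by move=> n; exact: outer_ge0.
have mF k n : mA0 (iter n S @^-1` F k n) by have [/coversP[]] := PF k.
apply: (@le_trans _ _ (\sum_(k <oo) pull_sum S m (F k))); last first.
  by apply: lee_nneseries => [k _ _|k _]; [exact: pull_sum_ge0 | case: (PF k)].
rewrite /pull_sum nneseries_interchange; last by move=> i j; exact: measure_ge0.
apply: (@le_trans _ _ (pull_sum S m (fun n => \bigcup_k F k n))).
  apply: outer_le; apply/coversP; split.
    by move=> n; rewrite preimage_bigcup; exact: bigcup_measurable.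
  move=> x [k _ Qx]; have [/coversP[_ /(_ x Qx)[n _ Fx]] _] := PF k.
  by exists n => //; exists k.
apply: lee_nneseries => [n _ _|n _]; first exact: measure_ge0.
rewrite preimage_bigcup; apply: measure_sigma_subadditive => //.
exact: bigcup_measurable.
Qed.

(** Applying S^M to a cover of S^-M Q and moving its indices up by [M] gives a cover of Q with the
    same sum, whose first [M] members are empty. *)
Lemma outer_le_shift m M Q : outer S A m Q <= outer S A m (iter M S @^-1` Q).
Proof.
apply: le_ereal_inf_tmp => _ [F /coversP[mF QF] <-].
pose G n := if (n < M)%N then set0 else iter M S @` F (n - M)%N.
have GE n : iter (M + n) S @^-1` G (M + n)%N = iter n S @^-1` F n.
  rewrite /G ltnNge leq_addr/= addKn; apply/seteqP; split=> x /=.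
    move=> [y Fy]; rewrite iterD => /(bij_inj (iter_bij M)) <- //.
  by move=> Fx; exists (iter n S x) => //; rewrite iterD.
apply: (@le_trans _ _ (pull_sum S m G)); last first.
  rewrite /pull_sum (nneseries_split 0 M); last by move=> n _; exact: measure_ge0.
  rewrite big1_seq ?add0e; last first.
    move=> n /=; rewrite mem_index_iota add0n => /andP[_ nM].
    by rewrite /G nM preimage_set0 measure0.
  rewrite add0n -nneseries_addn; last by move=> n; exact: measure_ge0.
  by apply: lee_nneseries => // n _; rewrite addnC GE.
apply: outer_le; apply/coversP; split=> [n|x Qx].
  have [nM|nM] := ltnP n M; first by rewrite /G nM preimage_set0; exact: measurable0.
  by rewrite -(subnKC nM) GE.
have [g fg gf] := iter_bij M.
have /QF[n _ Fn] : (iter M S @^-1` Q) (g x) by rewrite /= gf.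
exists (M + n)%N => //; rewrite /G ltnNge leq_addr/= addKn.
by exists (g x) => //; rewrite gf.
Qed.

(** A set of A_0 belongs to every A_(-n), so it splits each member of a cover into two admissible
    pieces. *)
Lemma outer_cut m Q B : mA0 B ->
  outer S A m (Q `&` B) + outer S A m (Q `&` ~` B) <= outer S A m Q.
Proof.
move=> mB; apply: le_ereal_inf_tmp => _ [F /coversP[mF QF] <-].
have mBn n : mA0 (iter n S @^-1` B) by exact: measurable_iter_shift.
have -> : pull_sum S m F = pull_sum S m (fun n => F n `&` B) +
    pull_sum S m (fun n => F n `&` ~` B).
  rewrite /pull_sum -nneseriesD; try by move=> n _ _; exact: measure_ge0.
  apply: eq_eseriesr => n _.
  rewrite !preimage_setI preimage_setC -setDE addeC.
  exact: (measureDI m (mF n) (mBn n)).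
have mIn C n : mA0 C -> mA0 (iter n S @^-1` F n `&` iter n S @^-1` C).
  by move=> mC; apply: (@measurableI _ T) => //; exact: measurable_iter_shift.
apply: leeD; apply: outer_le; apply/coversP; split=> [n|x [/QF[n _ Fx] Bx]].
- by rewrite preimage_setI; exact: mIn.
- by exists n.
- by rewrite preimage_setI; apply: mIn; exact: (@measurableC _ T).
- by exists n.
Qed.

End covering_sequences.

(** * An outer measure that is additive on the full sigma-algebra *)

Section invariant_outer_measure.
Variables (R : realType) (X : pointedType) (S : X -> X) (A : set (set X)).
Hypothesis bijS : bijective S.
Local Notation T := (A0T S A).
Local Notation mA0 := (@measurable _ T).
Local Open Scope ereal_scope.
Variable m : {measure set T -> \bar R}.
Hypothesis fm : fin_num_fun m.
Implicit Types (F G : nat -> set X) (Q B : set X).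

(* A set of A_(-k) can only split covers that use no index below k.  Covers of
   S^-M Q correspond to covers of Q without the first M indices, so the limit in
   M is additive on every A_(-k). *)
Definition outer_oo Q : \bar R :=
  ereal_sup [set outer S A m (iter M S @^-1` Q) | M in [set: nat]].

Lemma outer_shift_le_oo M Q : outer S A m (iter M S @^-1` Q) <= outer_oo Q.
Proof. by apply: ereal_sup_ubound; exists M. Qed.

Lemma outer_le_oo Q : outer S A m Q <= outer_oo Q.
Proof. exact: (outer_shift_le_oo 0). Qed.

Lemma outer_oo_setT : outer_oo setT = outer S A m setT.
Proof.
apply/eqP; rewrite eq_le outer_le_oo andbT.
by apply: ge_ereal_sup => _ [M _ <-]; rewrite preimage_setT.
Qed.

Lemma outer_oo_le_setT Q : outer_oo Q <= outer S A m setT.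
Proof. by apply: ge_ereal_sup => _ [M _ <-]; exact: le_outer. Qed.

Lemma outer_oo_ge0 Q : 0 <= outer_oo Q.
Proof. by apply: le_trans (outer_le_oo Q); exact: outer_ge0. Qed.

Lemma outer_oo_fin Q : outer_oo Q \is a fin_num.
Proof.
rewrite ge0_fin_numE ?outer_oo_ge0// (le_lt_trans (outer_oo_le_setT Q))//.
by rewrite ltey_eq outer_fin.
Qed.

Lemma outer_oo_set0 : outer_oo set0 = 0.
Proof.
apply/eqP; rewrite eq_le outer_oo_ge0 andbT; apply: ge_ereal_sup => _ [M _ <-].
by rewrite preimage_set0 outer_set0.
Qed.

Lemma le_outer_oo : {homo outer_oo : Q Q' / Q `<=` Q' >-> Q <= Q'}.
Proof.
move=> Q Q' QQ'; apply: ge_ereal_sup => _ [M _ <-].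
by apply: le_trans (outer_shift_le_oo M Q'); apply: le_outer => x /QQ'.
Qed.

Lemma outer_oo_sigma_subadditive : sigma_subadditive outer_oo.
Proof.
move=> Q; apply: ge_ereal_sup => _ [M _ <-]; rewrite preimage_bigcup.
apply: le_trans (outer_sigma_subadditive bijS fm _) _.
by apply: lee_nneseries => [n _ _|n _]; [exact: outer_ge0|exact: outer_shift_le_oo].
Qed.

Lemma outer_shift_nd M M' Q : (M <= M')%N ->
  outer S A m (iter M S @^-1` Q) <= outer S A m (iter M' S @^-1` Q).
Proof.
move=> MM'; rewrite (le_trans (outer_le_shift bijS m (M' - M) _))//.
apply: le_outer => x /=; by rewrite -iterD subnKC.
Qed.

Lemma outer_oo_cut k Q B : mA0 (iter k S @^-1` B) ->
  outer_oo (Q `&` B) + outer_oo (Q `&` ~` B) <= outer_oo Q.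
Proof.
move=> mB; rewrite -leeBrDr ?outer_oo_fin//.
apply: ge_ereal_sup => _ [M1 _ <-]; rewrite leeBrDr ?outer_oo_fin// addeC.
rewrite -leeBrDr ?outer_fin//.
apply: ge_ereal_sup => _ [M2 _ <-]; rewrite leeBrDr ?outer_fin// addeC.
(* Shifting by at least [k] brings B into A_0, where [outer_cut] applies; the shifts [M1] and [M2]
   of the two summands are absorbed by monotonicity in the shift. *)
pose M := maxn k (maxn M1 M2).
apply: le_trans (outer_shift_le_oo M Q).
have mBM : mA0 (iter M S @^-1` B).
  by apply: (measurable_Aneg_leq _ mB); rewrite leq_maxl.
have := outer_cut bijS m (iter M S @^-1` Q) mBM.
move=> /(le_trans _); apply; apply: leeD; apply: outer_shift_nd.
  by rewrite !leq_max leqnn orbT.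
by rewrite !leq_max leqnn !orbT.
Qed.

Let mu : {outer_measure set X -> \bar R} := HB.pack outer_oo
  (isOuterMeasure.Build R X outer_oo outer_oo_set0 outer_oo_ge0 le_outer_oo
     outer_oo_sigma_subadditive).

Let cara_Aneg k B : mA0 (iter k S @^-1` B) -> mu.-caratheodory B.
Proof.
by move=> mB; apply: le_caratheodory_measurable => Q; exact: (outer_oo_cut Q mB).
Qed.

(** Each generator lies in some A_(-n): the sets S^-n C in A_0, the sets S^n C in A_(-n). *)
Let cara_Bfull B : Bfull S A B -> mu.-caratheodory B.
Proof.
apply: smallest_sub.
  by have := @sigma_algebra_measurable _ (caratheodory_type mu).
move=> _ [n _ [] [C AC <-]].
  apply: (@cara_Aneg 0%N); rewrite /=.
  by apply: sub_sigma_algebra; exists n => //; exists C.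
apply: (@cara_Aneg n); apply/(AnegP A bijS); exists C => //.
by apply: sub_sigma_algebra; exists 0%N => //; exists C.
Qed.

(** [outer_oo] is additive on Q and its complement by Caratheodory, dominates the outer measure, and
    agrees with it on X. *)
Lemma outer_split Q : Bfull S A Q ->
  outer S A m Q + outer S A m (~` Q) <= outer S A m setT.
Proof.
move=> /cara_Bfull/(_ setT); rewrite /= outer_oo_setT => ->.
by rewrite !setTI leeD// outer_le_oo.
Qed.

Lemma outer_oo_sum G : (forall n, mA0 (iter n S @^-1` G n)) -> trivIset setT G ->
  \sum_(n <oo) outer_oo (G n) <= outer S A m setT.
Proof.
move=> mG tG; rewrite -outer_oo_setT.
have := @caratheodory_lime_le _ _ mu G (fun n => cara_Aneg (mG n)) tG setT.
apply: le_trans; under [in leRHS]eq_eseriesr do rewrite setTI.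
by rewrite leeDl ?outer_oo_ge0.
Qed.

End invariant_outer_measure.

(** * Adding an invariant measure to the covering cost *)

Section invariant_summand.
Variables (R : realType) (X : pointedType) (S : X -> X) (A : set (set X)).
Hypothesis bijS : bijective S.
Local Notation T := (A0T S A).
Local Notation mA0 := (@measurable _ T).
Local Open Scope ereal_scope.
Implicit Types (F G : nat -> set X) (Q B : set X).

(** Removing the earlier members keeps the n-th one in A_(-n) because the sigma-algebras A_(-n)
    increase with n. *)
Lemma covers_seqDU Q F : covers S A Q F -> covers S A Q (seqDU F).
Proof.
move=> /(coversP A bijS)[mF QF]; apply/(coversP A bijS); split=> [n|]; last first.
  by rewrite -seqDU_bigcup_eq.
rewrite /seqDU setDE preimage_setI -preimage_setC -setDE; apply: (@measurableD _ T) => //.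
apply: (big_ind (fun Q => mA0 (iter n S @^-1` Q))) => [|B C mB mC|k _].
- by rewrite preimage_set0; exact: (@measurable0 _ T).
- by rewrite preimage_setU; exact: (@measurableU _ T).
- by apply: (measurable_Aneg_leq _ (mF k)); exact: ltnW.
Qed.

Lemma le_pull_sum (m : {measure set T -> \bar R}) Q Q' F G :
  covers S A Q F -> covers S A Q' G -> (forall n, F n `<=` G n) ->
  pull_sum S m F <= pull_sum S m G.
Proof.
move=> /(coversP A bijS)[mF _] /(coversP A bijS)[mG _] FG.
apply: lee_nneseries => // n _.
by apply: (le_measure m); rewrite ?inE// => x; exact: FG.
Qed.

Lemma pull_sum_seqDU (m : {measure set T -> \bar R}) Q F :
  covers S A Q F -> pull_sum S m (seqDU F) <= pull_sum S m F.
Proof.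
by move=> QF; apply: (le_pull_sum m (covers_seqDU QF) QF) => n; exact: subDsetl.
Qed.

Variables (g L m : {measure set T -> \bar R}).
Hypotheses (fg : fin_num_fun g) (fL : fin_num_fun L) (fm : fin_num_fun m).
Hypothesis mD : forall B, mA0 B -> m B = g B + L B.
Hypothesis invL : forall B, mA0 B -> L (S @^-1` B) = L B.

Lemma invariant_iter n B : mA0 B -> L (iter n S @^-1` B) = L B.
Proof.
elim: n B => [//|n ih] B mB.
by rewrite (ih (S @^-1` B)) ?invL//; exact: measurable_shift.
Qed.

(** By invariance the first N terms can all be evaluated at the common time N, where they are the
    measures of disjoint subsets of S^-N B, a set of measure L B. *)
Lemma pull_sum_disjoint_le F B : (forall n, mA0 (iter n S @^-1` F n)) ->
  trivIset setT F -> mA0 B -> (forall n, F n `<=` B) -> pull_sum S L F <= L B.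
Proof.
move=> mF tF mB FB; apply: lime_le; first exact: is_cvg_nneseries.
apply: nearW => N.
have mFN n : (n < N)%N -> mA0 (iter N S @^-1` F n).
  by move=> nN; apply: (measurable_Aneg_leq _ (mF n)); exact: ltnW.
rewrite big_mkord.
rewrite (eq_bigr (fun n : 'I_N => L (iter N S @^-1` F n))); last first.
  move=> n _; rewrite -(invariant_iter (N - n) (mF n)).
  by congr (L _); apply/seteqP; split=> x /=; rewrite -iterD subnKC ?(ltnW (ltn_ord n)).
rewrite -measure_semi_additive_ord; last 3 first.
- by move=> n; exact: mFN.
- apply/trivIsetP => i j _ _ ij; rewrite -preimage_setI.
  have /trivIsetP/(_ i j Logic.I Logic.I) -> := tF; first exact: preimage_set0.
  by rewrite (inj_eq val_inj).
- by apply: bigsetU_measurable => n _; exact: mFN.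
rewrite -(invariant_iter N mB); apply: (le_measure L); rewrite ?inE.
- by apply: bigsetU_measurable => n _; exact: mFN.
- exact: measurable_iter_shift.
- rewrite -(bigcup_mkord N (fun n => iter N S @^-1` F n)).
  by apply: bigcup_sub => n _ x; exact: FB.
Qed.

Lemma pull_sumD F Q : covers S A Q F ->
  pull_sum S m F = pull_sum S g F + pull_sum S L F.
Proof.
move=> /(coversP A bijS)[mF _]; rewrite /pull_sum -nneseriesD//.
by apply: eq_eseriesr => n _; exact: mD.
Qed.

Lemma outer_superadditive Q : outer S A g Q + outer S A L Q <= outer S A m Q.
Proof.
apply: le_ereal_inf_tmp => _ [F QF <-]; rewrite (pull_sumD QF).
by apply: leeD; exact: outer_le.
Qed.

(** After a shift B becomes a set B' of A_0. Any cover of B', made disjoint and cut down to B',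
    costs no more for [g], and its L-sum is at most L B'. *)
Lemma outer_add_Aneg k B : mA0 (iter k S @^-1` B) ->
  outer S A m B <= outer_oo g B + L (iter k S @^-1` B).
Proof.
set B' := iter k S @^-1` B => mB.
rewrite (le_trans (outer_le_shift bijS m k B))// -/B'.
rewrite (@le_trans _ _ (outer S A g B' + L B'))//; last first.
  by rewrite leeD2r// outer_shift_le_oo.
rewrite -leeBlDr ?fL//; apply: le_ereal_inf_tmp => _ [F BF <-].
rewrite leeBlDr ?fL//.
pose G n := seqDU F n `&` B'.
have BDF := covers_seqDU BF.
have BG : covers S A B' G.
  have [mF BUF] := (coversP A bijS _ _).1 BDF.
  apply/(coversP A bijS); split=> [n|x Bx].
    rewrite preimage_setI; apply: (@measurableI _ T) => //.
    exact: measurable_iter_shift.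
  by have [n _ Fx] := BUF x Bx; exists n.
rewrite (le_trans (outer_le m BG))// (pull_sumD BG) leeD//.
  rewrite (le_trans _ (pull_sum_seqDU g BF))//.
  by apply: (le_pull_sum g BG BDF) => n; exact: subIsetl.
have [mG _] := (coversP A bijS _ _).1 BG.
apply: pull_sum_disjoint_le => //; last by move=> n; exact: subIsetr.
exact/trivIset_setIr/trivIset_seqDU.
Qed.

(** An arbitrary cover of X is made disjoint and [outer_add_Aneg] is applied to each member. The
    g-parts add up to at most the outer g-measure of X because [outer_oo] is additive; the L-parts
    add up to at most the L-sum of the cover. *)
Lemma outer_add_setT :
  outer S A m setT <= outer S A g setT + outer S A L setT.
Proof.
rewrite addeC -leeBlDr ?outer_fin//; apply: le_ereal_inf_tmp => _ [F TF <-].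
rewrite leeBlDr ?outer_fin// addeC.
have TG := covers_seqDU TF; have [mG TUG] := (coversP A bijS _ _).1 TG.
rewrite (le_trans (le_outer m TUG))//.
rewrite (le_trans (outer_sigma_subadditive bijS fm _))//.
rewrite (@le_trans _ _ (\sum_(n <oo) (outer_oo g (seqDU F n) +
    L (iter n S @^-1` seqDU F n))))//.
  by apply: lee_nneseries => [n _ _|n _]; [exact: outer_ge0|exact: outer_add_Aneg].
rewrite nneseriesD//; last by move=> n _ _; exact: outer_oo_ge0.
rewrite leeD//; last exact: pull_sum_seqDU TF.
by apply: outer_oo_sum => //; exact: trivIset_seqDU.
Qed.

(* This is not deduced from an extension of L to a measure on Bfull: without a
   regularity assumption, outer S A L setT can be smaller than L setT. *)
Lemma outer_add Q : Bfull S A Q ->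
  outer S A m Q <= outer S A g Q + outer S A L Q.
Proof.
(* With c for the complement: m Q <= m X - m Qc <= g X + L X - g Qc - L Qc <= g Q + L Q, all values
   being outer measures. *)
move=> BQ; have := outer_split bijS fm BQ.
have sub (k : {measure set T -> \bar R}) (fk : fin_num_fun k) :
    outer S A k setT <= outer S A k Q + outer S A k (~` Q).
  have := outer_sigma_subadditive bijS fk (bigcup2 Q (~` Q)).
  rewrite bigcup2E setUv => /le_trans; apply.
  rewrite (nneseries_split 0 2); last by move=> n _; exact: outer_ge0.
  rewrite add0n [X in _ + X]eseries0; last first.
    by move=> [//|[//|n]] _ _ /=; rewrite outer_set0.
  by rewrite adde0 big_mkord !big_ord_recl big_ord0 adde0.
have := outer_superadditive (~` Q); have := sub _ fg; have := sub _ fL.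
have := outer_add_setT.
have E (k : {measure set T -> \bar R}) (fk : fin_num_fun k) W :
    exists r : R, outer S A k W = r%:E.
  by exists (fine (outer S A k W)); rewrite fineK// outer_fin.
have [r1 ->] := E m fm Q; have [r2 ->] := E m fm (~` Q); have [r3 ->] := E m fm setT.
have [s1 ->] := E g fg Q; have [s2 ->] := E g fg (~` Q); have [s3 ->] := E g fg setT.
have [t1 ->] := E L fL Q; have [t2 ->] := E L fL (~` Q); have [t3 ->] := E L fL setT.
rewrite -!EFinD !lee_fin; lra.
Qed.

End invariant_summand.

(** * Densities and sums of integrals over a cover *)

Section measure_with_density.
Context d (T : measurableType d) (R : realType) (mu : {measure set T -> \bar R}).
Local Open Scope ereal_scope.

Lemma density_measure (f : T -> R) : measurable_fun setT f ->
  (forall x, (0 <= f x)%R) ->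
  exists m : {measure set T -> \bar R},
    forall E, m E = \int[mu]_(x in E) (f x)%:E.
Proof.
move=> mf f0; pose m0 E := \int[mu]_(x in E) (f x)%:E.
have m00 : m0 set0 = 0 by exact: integral_set0.
have m0_ge0 E : 0 <= m0 E by apply: integral_ge0 => x _; rewrite lee_fin.
have m0_sigma : semi_sigma_additive m0.
  move=> F mF tF mUF; rewrite /m0 ge0_integral_bigcup//.
  - by apply: is_cvg_nneseries => n _ _; exact: m0_ge0.
  - by apply/measurable_EFinP; exact: measurable_funTS.
  - by move=> x _; rewrite lee_fin.
pose m : {measure set T -> \bar R} :=
  HB.pack m0 (isMeasure.Build _ _ _ m0 m00 m0_ge0 m0_sigma).
by exists m.
Qed.

End measure_with_density.

Section dominated_series.
Context d (T : measurableType d) (R : realType).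
Variables (mu : {finite_measure set T -> \bar R}) (z : T -> R).
Hypothesis z_ge0 : forall x, 0 <= z x.
Hypothesis iz : mu.-integrable setT (EFin \o z).

(** Such functions have absolutely convergent sums of integrals over every sequence of sets on which
    1 + z has a finite sum, so these sums are real numbers, linear and monotone in f. *)
Definition dominated (f : T -> R) :=
  measurable_fun setT f /\ exists C, forall x, `|f x| <= C * (1 + z x).

Let mz : measurable_fun setT z.
Proof. by case/integrableP : iz => /measurable_EFinP. Qed.

Let m1z : measurable_fun setT (fun x => 1 + z x).
Proof. exact: measurable_funD. Qed.

Lemma dominated_ge0 (f : T -> R) : measurable_fun setT f -> (forall x, 0 <= f x) ->
  (forall x, f x <= 1 + z x) -> dominated f.
Proof.
by move=> mf f0 fz; split=> //; exists 1 => x; rewrite mul1r ger0_norm.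
Qed.

Lemma dominated_lin f g c : dominated f -> dominated g ->
  dominated (fun x => f x + c * g x).
Proof.
move=> [mf [C fC]] [mg [D gD]]; split.
  by apply: measurable_funD => //; exact: measurable_funM.
exists (C + `|c| * D) => x; rewrite mulrDl (le_trans (ler_normD _ _))// lerD//.
by rewrite normrM -mulrA ler_wpM2l.
Qed.

Lemma integrable_dominated f E : measurable E -> dominated f ->
  mu.-integrable E (EFin \o f).
Proof.
move=> mE [mf [C fC]]; apply: (@integrableS _ _ _ _ setT) => //.
apply: (@le_integrable _ _ _ _ _ measurableT _ (EFin \o (fun x => C * (1 + z x)))).
- exact/measurable_EFinP.
- by move=> x _; rewrite /= lee_fin (le_trans (fC x))// ler_norm.
- have -> : EFin \o (fun x => C * (1 + z x)) =
      (fun x => C%:E * (((EFin \o cst 1%R) : T -> \bar R) x + (EFin \o z) x))%E.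
    by apply/funext => x /=; rewrite EFinM.
  apply: integrableZl => //; apply: integrableD => //.
  exact: finite_measure_integrable_cst.
Qed.

Variable E : nat -> set T.
Hypothesis mE : forall n, measurable (E n).
Hypothesis sE : (\sum_(0 <= n <oo) \int[mu]_(x in E n) (1 + z x)%:E < +oo)%E.

Definition int_series f : R := limn (series (fun n => \int[mu]_(x in E n) f x)).

Let EFin_int f n : dominated f ->
  (\int[mu]_(x in E n) (f x)%:E = (\int[mu]_(x in E n) f x)%:E)%E.
Proof.
move=> df; rewrite fineK//; apply: integrable_fin_num => //.
exact: integrable_dominated.
Qed.

Let dom1z : dominated (fun x => 1 + z x).
Proof. by apply: dominated_ge0 => // x; rewrite addr_ge0. Qed.

Let int1z_ge0 n : 0 <= \int[mu]_(x in E n) (1 + z x).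
Proof. by apply: Rintegral_ge0 => x _; rewrite addr_ge0. Qed.

Let cvg1z : cvgn (series (fun n => \int[mu]_(x in E n) (1 + z x))).
Proof.
apply: nondecreasing_is_cvgn; first by apply: nondecreasing_series => n _ _.
exists (fine (\sum_(0 <= n <oo) \int[mu]_(x in E n) (1 + z x)%:E)%E) => _ [N _ <-].
have s0 n : (0 <= \int[mu]_(x in E n) (1 + z x)%:E)%E.
  by apply: integral_ge0 => x _; rewrite lee_fin addr_ge0.
rewrite -lee_fin fineK; last by rewrite ge0_fin_numE// nneseries_ge0.
rewrite /series/= -sumEFin; under eq_bigr do rewrite -EFin_int//.
exact: nneseries_lim_ge.
Qed.

Lemma cvg_int_series f : dominated f ->
  cvgn (series (fun n => \int[mu]_(x in E n) f x)).
Proof.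
move=> df; case: (df) => mf [C fC]; apply: normed_cvg.
apply: (@series_le_cvg _ _ (fun n => `|C| * \int[mu]_(x in E n) (1 + z x))) => //.
- by move=> n /=.
- by move=> n; rewrite mulr_ge0.
- move=> n /=; rewrite -RintegralZl//; last exact: integrable_dominated.
  rewrite (le_trans (le_normr_Rintegral _ _))//; first exact: integrable_dominated.
  apply: le_Rintegral => //.
  + apply: integrable_dominated => //; split; first exact: measurableT_comp.
    by exists C => x; rewrite normr_id.
  + have -> : EFin \o (fun x => `|C| * (1 + z x)) =
      (fun x => `|C|%:E * (EFin \o (fun x => (1 + z x)%R)) x)%E by [].
    by apply: integrableZl => //; exact: integrable_dominated.
  + by move=> x _; rewrite (le_trans (fC x))// ler_wpM2r ?addr_ge0// ler_norm.
- have -> : (fun n => `|C| * \int[mu]_(x in E n) (1 + z x)) =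
      `|C| *: (fun n => \int[mu]_(x in E n) (1 + z x)) by [].
  exact: is_cvg_seriesZ.
Qed.

Lemma eseries_int f : dominated f ->
  (\sum_(0 <= n <oo) \int[mu]_(x in E n) (f x)%:E = (int_series f)%:E)%E.
Proof.
move=> df; under eq_eseriesr do rewrite EFin_int//.
rewrite /int_series -EFin_lim; last exact: cvg_int_series.
by apply/congr_lim/funext => n; rewrite /= sumEFin.
Qed.

Lemma int_series_lin f g c : dominated f -> dominated g ->
  int_series (fun x => f x + c * g x) = int_series f + c * int_series g.
Proof.
move=> df dg.
have [cf cg] := (cvg_int_series df, cvg_int_series dg).
have -> : c * int_series g = c *: int_series g by [].
rewrite /int_series -lim_seriesZ// -lim_seriesD//; last exact: is_cvg_seriesZ.
congr (limn (series _)); apply/funext => n.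
have i2 : mu.-integrable (E n) (EFin \o (fun x => c * g x)).
  have -> : EFin \o (fun x => c * g x) = (fun x => c%:E * (EFin \o g) x)%E by [].
  by apply: integrableZl => //; exact: integrable_dominated.
rewrite RintegralD//; last exact: integrable_dominated.
by rewrite RintegralZl//; exact: integrable_dominated.
Qed.

Lemma le_int_series f g : dominated f -> dominated g -> (forall x, f x <= g x) ->
  int_series f <= int_series g.
Proof.
move=> df dg fg; apply: lim_series_le; [exact: cvg_int_series..|move=> n].
by apply: le_Rintegral => //; exact: integrable_dominated.
Qed.

End dominated_series.

Section finite_version.
Context d (T : measurableType d) (R : realType) (mu : {measure set T -> \bar R}).
Variable Z : T -> \bar R.
Hypothesis Z_ge0 : forall x, (0 <= Z x)%E.
Hypothesis iZ : mu.-integrable setT Z.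
Let z x := fine (Z x).

Lemma integrable_fine : mu.-integrable setT (EFin \o z).
Proof.
have mZ : measurable_fun setT Z by exact: measurable_int iZ.
apply: le_integrable iZ => //; first exact/measurable_EFinP/measurableT_comp.
by move=> x _; rewrite /= /z; have := Z_ge0 x; case: (Z x) => //=; rewrite normr0 leey.
Qed.

Lemma integral_fineE (f : \bar R -> \bar R) (h : R -> R) E :
  (forall r, 0 <= r -> f r%:E = (h r)%:E) -> f +oo%E = +oo%E ->
  measurable_fun setT (h \o z) -> measurable E ->
  (\int[mu]_(x in E) f (Z x) = \int[mu]_(x in E) (h (z x))%:E)%E.
Proof.
move=> fh foo mh mE.
have mZ : measurable_fun setT Z by exact: measurable_int iZ.
have mz : measurable_fun setT (EFin \o z) by exact: measurable_int integrable_fine.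
(* The correction Z - z is 0 where Z is finite and +oo elsewhere; this identity yields the
   measurability of f(Z), and integrability of Z makes the correction vanish almost everywhere. *)
have fE : (fun x => f (Z x)) = (fun x => (h (z x))%:E + (Z x - (z x)%:E))%E.
  apply/funext => x; rewrite /z; have := Z_ge0 x.
  case: (Z x) => [r| |].
  - by rewrite lee_fin => r0; rewrite subee// adde0 fh.
  - by rewrite foo.
  - by rewrite leNgt ltNye.
apply: ae_eq_integral => //.
- rewrite fE; apply: measurable_funTS; apply: emeasurable_funD.
    exact/measurable_EFinP.
  exact: emeasurable_funB.
- by apply: measurable_funTS; exact/measurable_EFinP.
- have : {ae mu, forall x, setT x -> Z x \is a fin_num} by exact: integrable_ae iZ.
  apply: filterS => x /(_ Logic.I) Zx _; rewrite /z.
  have := Z_ge0 x; rewrite -(fineK Zx) lee_fin => r0.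
  by rewrite fh.
Qed.

End finite_version.

(** * Limits at 0+ over shrinking classes of covers, as suprema of infima and infima of suprema *)

Section limits_over_covers.
Variables (R : realType) (X : pointedType) (S : X -> X).
Variables (C : R -> set (nat -> set X)) (g : set X -> \bar R).
Hypothesis C_nd : forall e e', e <= e' -> C e `<=` C e'.
Local Open Scope ereal_scope.
Implicit Type x : \bar R.

Lemma lim_inf_overE : lim_inf_over S C g =
  ereal_sup [set ereal_inf [set pull_sum S g F | F in C e] | e in `]0%R, +oo[].
Proof.
apply/cvg_lim => //; apply: nonincreasing_at_right_cvge => // e e' _ _ ee'.
apply: le_ereal_inf_tmp => _ [F CF <-]; apply: ereal_inf_lbound.
by exists F => //; exact: C_nd CF.
Qed.

Lemma lim_sup_overE : lim_sup_over S C g =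
  ereal_inf [set ereal_sup [set pull_sum S g F | F in C e] | e in `]0%R, +oo[].
Proof.
apply/cvg_lim => //; apply: nondecreasing_at_right_cvge => // e e' _ _ ee'.
apply: ge_ereal_sup => _ [F CF <-]; apply: ereal_sup_ubound.
by exists F => //; exact: C_nd CF.
Qed.

Let gt0_itv (e : R) : (0 < e)%R -> (e \in `]0%R, +oo[).
Proof. by rewrite in_itv/= andbT. Qed.

Lemma lim_inf_over_gt x : x < lim_inf_over S C g ->
  exists2 e, (0 < e)%R & forall F, C e F -> x < pull_sum S g F.
Proof.
rewrite lim_inf_overE => /ereal_sup_gt[_ [e + <-] xe].
rewrite /= in_itv/= andbT => e0; exists e => // F CF.
by apply: (lt_le_trans xe); apply: ereal_inf_lbound; exists F.
Qed.

Lemma lim_inf_over_lt x e : lim_inf_over S C g < x -> (0 < e)%R ->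
  exists2 F, C e F & pull_sum S g F < x.
Proof.
rewrite lim_inf_overE => lx e0.
have /ereal_inf_lt[_ [F CF <-] Fx] : ereal_inf [set pull_sum S g F | F in C e] < x.
  by apply: le_lt_trans lx; apply: ereal_sup_ubound; exists e => //; exact: gt0_itv.
by exists F.
Qed.

Lemma lim_inf_over_ge x e : (0 < e)%R ->
  (forall F, C e F -> x <= pull_sum S g F) -> x <= lim_inf_over S C g.
Proof.
move=> e0 xC; rewrite lim_inf_overE.
apply: (@le_trans _ _ (ereal_inf [set pull_sum S g F | F in C e])).
  by apply: le_ereal_inf_tmp => _ [F CF <-]; exact: xC.
by apply: ereal_sup_ubound; exists e => //; exact: gt0_itv.
Qed.

Lemma lim_inf_over_le x :
  (forall e, (0 < e)%R -> exists2 F, C e F & pull_sum S g F <= x) ->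
  lim_inf_over S C g <= x.
Proof.
move=> Cx; rewrite lim_inf_overE; apply: ge_ereal_sup => _ [e + <-].
rewrite /= in_itv/= andbT => /Cx[F CF Fx].
by apply: le_trans Fx; apply: ereal_inf_lbound; exists F.
Qed.

Lemma lim_sup_over_lt x : lim_sup_over S C g < x ->
  exists2 e, (0 < e)%R & forall F, C e F -> pull_sum S g F < x.
Proof.
rewrite lim_sup_overE => /ereal_inf_lt[_ [e + <-] xe].
rewrite /= in_itv/= andbT => e0; exists e => // F CF.
by apply: (le_lt_trans _ xe); apply: ereal_sup_ubound; exists F.
Qed.

Lemma lim_sup_over_gt x e : x < lim_sup_over S C g -> (0 < e)%R ->
  exists2 F, C e F & x < pull_sum S g F.
Proof.
rewrite lim_sup_overE => lx e0.
have /ereal_sup_gt[_ [F CF <-] Fx] : x < ereal_sup [set pull_sum S g F | F in C e].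
  by apply: lt_le_trans lx _; apply: ereal_inf_lbound; exists e => //; exact: gt0_itv.
by exists F.
Qed.

Lemma lim_sup_over_le x e : (0 < e)%R ->
  (forall F, C e F -> pull_sum S g F <= x) -> lim_sup_over S C g <= x.
Proof.
move=> e0 xC; rewrite lim_sup_overE.
apply: (@le_trans _ _ (ereal_sup [set pull_sum S g F | F in C e])).
  by apply: ereal_inf_lbound; exists e => //; exact: gt0_itv.
by apply: ge_ereal_sup => _ [F CF <-]; exact: xC.
Qed.

Lemma lim_sup_over_ge x :
  (forall e, (0 < e)%R -> exists2 F, C e F & x <= pull_sum S g F) ->
  x <= lim_sup_over S C g.
Proof.
move=> Cx; rewrite lim_sup_overE; apply: le_ereal_inf_tmp => _ [e + <-].
rewrite /= in_itv/= andbT => /Cx[F CF Fx].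
by apply: le_trans Fx _; apply: ereal_sup_ubound; exists F.
Qed.

End limits_over_covers.

Section nearly_optimal_monotone.
Variables (R : realType) (X : pointedType) (S : X -> X).

Lemma nearly_optimal_nd (C C' : set (nat -> set X)) (g : set X -> \bar R) v e e' :
  C `<=` C' -> e <= e' -> nearly_optimal S C g v e `<=` nearly_optimal S C' g v e'.
Proof.
move=> CC' ee' F [CF Fe]; split; first exact: CC'.
by apply: (lt_le_trans Fe); rewrite leeD2l// lee_fin.
Qed.

End nearly_optimal_monotone.

(** * Near-optimal covers *)

Section near_optimal_covers.
Variables (R : realType) (X : pointedType) (S : X -> X) (A : set (set X)).
Local Notation T := (A0T S A).
Local Notation mA0 := (@measurable _ T).
Variables (phi0 Lambda : {finite_measure set T -> \bar R}) (Z : T -> \bar R).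
Hypothesis bijS : bijective S.
Hypothesis invLambda : forall B : set X, A0 S A B -> Lambda (S @^-1` B) = Lambda B.
Hypothesis Z_ge0 : forall x, (0 <= Z x)%E.
Hypothesis mZ : measurable_fun setT Z.
Hypothesis Z_density : forall B : set T, A0 S A B ->
  Lambda B = (\int[phi0]_(x in B) Z x)%E.

Let z (x : T) : R := fine (Z x).
Let pw a (x : T) : R := z x `^ a.
Let pwln a (x : T) : R := z x `^ a * ln (z x).

Let iZ : phi0.-integrable setT Z.
Proof.
apply/integrableP; split=> //.
rewrite (eq_integral Z) => [|x _]; last by rewrite gee0_abs.
rewrite -Z_density; last exact: (@measurableT _ T).
by rewrite ltey_eq fin_num_measure.
Qed.

Let iz : phi0.-integrable setT (EFin \o z).
Proof. exact: integrable_fine iZ. Qed.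

Let z_ge0 x : 0 <= z x. Proof. exact: fine_ge0. Qed.

Let mz : measurable_fun setT z.
Proof. by case/integrableP : iz => /measurable_EFinP. Qed.

Let mpw a : measurable_fun setT (pw a).
Proof. exact: (measurableT_comp (measurable_powR a) mz). Qed.

Let mpwln a : measurable_fun setT (pwln a).
Proof.
apply: measurable_funM; first exact: mpw.
exact: (measurableT_comp (@measurable_ln R) mz).
Qed.

Let dom1 : dominated z (fun=> 1).
Proof. by apply: dominated_ge0 => // x; rewrite lerDl. Qed.

Let domz : dominated z z.
Proof. by apply: dominated_ge0 => // x; rewrite lerDr. Qed.

Let dompw a : 0 < a < 1 -> dominated z (pw a).
Proof.
move=> /andP[a0 a1]; apply: dominated_ge0 => // x; first exact: powR_ge0.
by apply: powR_le1D => //; rewrite !ltW.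
Qed.

Let dompwln a : 0 < a < 1 -> dominated z (pwln a).
Proof.
move=> a01; split=> //; exists (a^-1 + (1 - a)^-1) => x.
exact: norm_powR_ln_le.
Qed.

Let LambdaE B : mA0 B -> Lambda B = (\int[phi0]_(x in B) (z x)%:E)%E.
Proof.
move=> mB; rewrite Z_density//.
exact: (@integral_fineE _ T R phi0 Z Z_ge0 iZ id id B).
Qed.

Let phi0E B : mA0 B -> phi0 B = (\int[phi0]_(x in B) (1 : R)%:E)%E.
Proof. by move=> mB; rewrite (integral_cst phi0 mB 1%E) mul1e. Qed.

Let pow_intE a B : 0 < a < 1 -> mA0 B ->
  pow_int phi0 Z a B = (\int[phi0]_(x in B) (pw a x)%:E)%E.
Proof.
move=> /andP[a0 _] mB; rewrite /pow_int.
apply: (@integral_fineE _ T R phi0 Z Z_ge0 iZ (fun y => (y `^ a)%E) (fun r => r `^ a) B) => //.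
- by rewrite poweRyr// gt_eqF.
- exact: mpw.
Qed.

Let pow_log_intE a B : 0 < a < 1 -> mA0 B ->
  pow_log_int phi0 Z a B = (\int[phi0]_(x in B) (pwln a x)%:E)%E.
Proof.
move=> /andP[a0 _] mB; rewrite /pow_log_int.
apply: (@integral_fineE _ T R phi0 Z Z_ge0 iZ (fun y => (y `^ a * lne y)%E)
  (fun r => r `^ a * ln r) B) => //.
- move=> r; rewrite le_eqVlt => /predU1P[<-|r0].
    by rewrite poweR_EFin powR0 ?gt_eqF// mul0e mul0r.
  by rewrite lne_EFin// poweR_EFin EFinM.
- by rewrite poweRyr ?gt_eqF.
- exact: mpwln.
Qed.

Local Notation pre F := (fun n => iter n S @^-1` F n).
Local Notation "'I[ f ] F" := (int_series phi0 (pre F : nat -> set T) f)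
  (at level 10, F at level 8).

Let pull_sumE (g : set X -> \bar R) f F : (forall n, mA0 (pre F n)) ->
  (forall B, mA0 B -> g B = \int[phi0]_(x in B) (f x)%:E)%E ->
  (pull_sum S g F = \sum_(0 <= n <oo) \int[phi0]_(x in pre F n) (f x)%:E)%E.
Proof. by move=> mF gf; apply: eq_eseriesr => n _; exact: gf. Qed.

(** On these covers 1 + z has a finite sum, so all sums of dominated functions are real. *)
Definition tame (Q : set X) (F : nat -> set X) :=
  [/\ covers S A Q F, (pull_sum S phi0 F < +oo)%E &
      (pull_sum S Lambda F < +oo)%E].

Let tame_meas Q F : tame Q F -> forall n, mA0 (pre F n).
Proof. by case=> /(coversP A bijS)[]. Qed.

Let tame_sum Q F : tame Q F ->
  (\sum_(0 <= n <oo) \int[phi0]_(x in pre F n) (1 + z x)%:E < +oo)%E.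
Proof.
move=> tF; have mF := tame_meas tF; case: tF => _.
rewrite (pull_sumE mF phi0E) (pull_sumE mF LambdaE) => N L.
have -> : (\sum_(0 <= n <oo) \int[phi0]_(x in pre F n) (1 + z x)%:E =
    \sum_(0 <= n <oo) (\int[phi0]_(x in pre F n) (1 : R)%:E +
                       \int[phi0]_(x in pre F n) (z x)%:E))%E.
  apply: eq_eseriesr => n _; under eq_integral do rewrite EFinD.
  rewrite ge0_integralD//.
  - by move=> x _; rewrite lee_fin.
  - by apply: measurable_funTS; exact/measurable_EFinP.
rewrite nneseriesD ?lte_add_pinfty//.
- by move=> n _ _; apply: integral_ge0 => x _; rewrite lee_fin.
- by move=> n _ _; apply: integral_ge0 => x _; rewrite lee_fin.
Qed.

Let tame_int Q F f g : tame Q F -> dominated z f ->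
  (forall B, mA0 B -> g B = \int[phi0]_(x in B) (f x)%:E)%E ->
  pull_sum S g F = ('I[f] F)%:E.
Proof.
move=> tF df gf; have mF := tame_meas tF.
rewrite (pull_sumE mF gf) (eseries_int z_ge0 iz mF)//.
exact: tame_sum tF.
Qed.

Let tame_lin Q F f g c : tame Q F -> dominated z f -> dominated z g ->
  'I[fun x => f x + c * g x] F = 'I[f] F + c * 'I[g] F.
Proof.
move=> tF df dg.
exact: (int_series_lin z_ge0 iz (tame_meas tF) (tame_sum tF) _ df dg).
Qed.

Let tame_le Q F f g : tame Q F -> dominated z f -> dominated z g ->
  (forall x, f x <= g x) -> 'I[f] F <= 'I[g] F.
Proof.
move=> tF df dg.
exact: (le_int_series z_ge0 iz (tame_meas tF) (tame_sum tF) df dg).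
Qed.

Let tame_ge0 Q F f : tame Q F -> dominated z f -> (forall x, 0 <= f x) ->
  0 <= 'I[f] F.
Proof.
move=> tF df f0; have := tame_le tF (dominated_lin (-1) df df) df.
rewrite (tame_lin _ tF df df) mulN1r subrr; apply=> x.
by rewrite mulN1r subrr.
Qed.

Let tame_convex Q F a b : tame Q F -> 0 < a < 1 -> 0 < b < 1 ->
  'I[pw a] F + 'I[pwln a] F * (b - a) <= 'I[pw b] F.
Proof.
move=> tF a01 b01; have [da db] := (dompw a01, dompw b01).
have dl := dompwln a01; rewrite mulrC -(tame_lin _ tF da dl).
apply: (tame_le tF (dominated_lin _ da dl) db) => x.
by rewrite mulrC; apply: powR_expansion_ge => //; case/andP: a01 => /lt0r_neq0.
Qed.

Let tame_semiconcave Q F e a b : tame Q F -> 0 < e -> e <= a <= 1 - e ->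
  e <= b <= 1 - e ->
  'I[pw b] F <= 'I[pw a] F + 'I[pwln a] F * (b - a) +
     16 / e ^+ 2 * (b - a) ^+ 2 * ('I[fun=> 1] F + 'I[z] F).
Proof.
move=> tF e0 ea eb.
have a01 : 0 < a < 1 by case/andP: ea => ? ?; apply/andP; split; lra.
have b01 : 0 < b < 1 by case/andP: eb => ? ?; apply/andP; split; lra.
have [da db] := (dompw a01, dompw b01); have dl := dompwln a01.
set C := _ * (b - a) ^+ 2.
have d1 := dominated_lin (b - a) da dl.
have d2 := dominated_lin C d1 dom1; have d3 := dominated_lin C d2 domz.
have := tame_le tF db d3.
rewrite (tame_lin _ tF d2 domz) (tame_lin _ tF d1 dom1) (tame_lin _ tF da dl).
rewrite [C * (_ + _)]mulrDr addrA [_ * (b - a)]mulrC; apply=> x.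
have := powR_expansion_le (z_ge0 x) e0 ea eb.
by rewrite -/C /pw /pwln; lra.
Qed.

Let tame_log_bound Q F a : tame Q F -> 0 < a < 1 ->
  `|'I[pwln a] F| <= (a^-1 + (1 - a)^-1) * ('I[fun=> 1] F + 'I[z] F).
Proof.
move=> tF a01; have dl := dompwln a01; set C := _ + _.
have d0 : dominated z (fun=> 0).
  by apply: dominated_ge0 => // x; rewrite addr_ge0.
have I0 : 'I[fun=> 0] F = 0.
  apply/eqP; rewrite eq_le (tame_ge0 tF d0)// andbT.
  have : 'I[fun=> 0] F <= 'I[fun=> 1] F + -1 * 'I[fun=> 1] F.
    rewrite -(tame_lin (-1) tF dom1 dom1).
    by apply: (tame_le tF d0 (dominated_lin (-1) dom1 dom1)) => x; lra.
  by rewrite mulN1r subrr.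
have d1 := dominated_lin C d0 dom1; have d2 := dominated_lin C d1 domz.
have E : C * ('I[fun=> 1] F + 'I[z] F) = 'I[fun x => 0 + C * 1 + C * z x] F.
  by rewrite (tame_lin _ tF d1 domz) (tame_lin _ tF d0 dom1) I0 add0r mulrDr.
have hx x : `|pwln a x| <= 0 + C * 1 + C * z x.
  by rewrite add0r -mulrDr; exact: norm_powR_ln_le.
rewrite E ler_norml; apply/andP; split.
  rewrite -subr_ge0 opprK addrC -[X in _ + X]mul1r -(tame_lin 1 tF d2 dl).
  rewrite -[X in X <= _]I0.
  apply: (tame_le tF d0 (dominated_lin 1 d2 dl)) => x.
  by have := hx x; rewrite ler_norml mul1r => /andP[+ _]; lra.
by apply: (tame_le tF dl d2) => x; exact: le_trans (ler_norm _) (hx x).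
Qed.

(** * The Hellinger function of a fixed set *)

Variable Q : set X.
Hypothesis BQ : Bfull S A Q.

Let P := fine (outer S A phi0 Q).
Let L0 := fine (outer S A Lambda Q).
Let M := fine (Lambda setT).
Let H a := fine (hellinger0 phi0 Z a Q).
Let N F := 'I[fun=> 1] F.
Let L F := 'I[z] F.
Let h a F := 'I[pw a] F.
Let d a F := 'I[pwln a] F.

Let fin_phi0 : fin_num_fun phi0 := @fin_num_measure _ _ _ phi0.
Let fin_Lambda : fin_num_fun Lambda := @fin_num_measure _ _ _ Lambda.

Let outer_phi0E : outer S A phi0 Q = P%:E.
Proof. by rewrite fineK// outer_fin. Qed.

Let outer_LambdaE : outer S A Lambda Q = L0%:E.
Proof. by rewrite fineK// outer_fin. Qed.

Let LambdaTE : Lambda setT = M%:E.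
Proof. by rewrite fineK// fin_Lambda//; exact: (@measurableT _ T). Qed.

Let NE F : tame Q F -> pull_sum S phi0 F = (N F)%:E.
Proof. by move=> tF; exact: (tame_int tF dom1 phi0E). Qed.

Let LE F : tame Q F -> pull_sum S Lambda F = (L F)%:E.
Proof. by move=> tF; exact: (tame_int tF domz LambdaE). Qed.

Let hE a F : 0 < a < 1 -> tame Q F -> pull_sum S (pow_int phi0 Z a) F = (h a F)%:E.
Proof.
by move=> a01 tF; apply: (tame_int tF (dompw a01)) => B; exact: pow_intE.
Qed.

Let dE a F : 0 < a < 1 -> tame Q F ->
  pull_sum S (pow_log_int phi0 Z a) F = (d a F)%:E.
Proof.
by move=> a01 tF; apply: (tame_int tF (dompwln a01)) => B; exact: pow_log_intE.
Qed.

Let N_ge F : tame Q F -> P <= N F.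
Proof.
by move=> tF; rewrite -lee_fin -NE// -outer_phi0E; case: tF => + _ _; exact: outer_le.
Qed.

Let L_ge F : tame Q F -> L0 <= L F.
Proof.
by move=> tF; rewrite -lee_fin -LE// -outer_LambdaE; case: tF => + _ _; exact: outer_le.
Qed.

Let seqDU_le F (f : T -> R) (g : set X -> \bar R) : covers S A Q F -> measurable_fun setT f ->
  (forall x, 0 <= f x) -> (forall B, mA0 B -> g B = \int[phi0]_(x in B) (f x)%:E)%E ->
  (pull_sum S g (seqDU F) <= pull_sum S g F)%E.
Proof.
move=> QF mf f0 gf; have [m mE] := density_measure phi0 mf f0.
have gm G : covers S A Q G -> pull_sum S g G = pull_sum S m G.
  by move=> /(coversP A bijS)[mG _]; apply: eq_eseriesr => n _; rewrite mE gf.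
rewrite !gm//; last exact: covers_seqDU.
exact: (pull_sum_seqDU bijS m QF).
Qed.

(** A cover of finite phi_0-sum may have infinite Lambda-sum; once it is disjoint, invariance bounds
    that sum by Lambda(X). *)
Let tame_seqDU F : covers S A Q F -> (pull_sum S phi0 F < +oo)%E ->
  tame Q (seqDU F) /\ L (seqDU F) <= M.
Proof.
move=> QF Noo; have QG := covers_seqDU bijS QF.
have LM : (pull_sum S Lambda (seqDU F) <= M%:E)%E.
  rewrite -LambdaTE; have [mG _] := (coversP A bijS _ _).1 QG.
  exact: (pull_sum_disjoint_le invLambda mG (@trivIset_seqDU _ F) (@measurableT _ T)).
have tG : tame Q (seqDU F).
  split=> //; last by rewrite (le_lt_trans LM)// ltry.
  exact: le_lt_trans (pull_sum_seqDU bijS phi0 QF) Noo.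
by split=> //; rewrite -lee_fin -LE.
Qed.

Let cov0_nd e e' : e <= e' -> cov0 phi0 Q e `<=` cov0 phi0 Q e'.
Proof. by move=> ee'; exact: nearly_optimal_nd. Qed.

Let cov0_tame e F : tame Q F -> cov0 phi0 Q e F <-> N F < P + e.
Proof.
move=> tF; rewrite /cov0 /nearly_optimal /= NE// outer_phi0E -EFinD lte_fin.
by split=> [[]//|?]; split=> //; case: tF.
Qed.

Let cov0_lty e F : cov0 phi0 Q e F -> (pull_sum S phi0 F < +oo)%E.
Proof.
move=> [_ Fe]; apply: (lt_trans Fe).
by rewrite outer_phi0E -EFinD ltry.
Qed.

Let cov0_seqDU e F : cov0 phi0 Q e F ->
  [/\ tame Q (seqDU F), N (seqDU F) < P + e & L (seqDU F) <= M].
Proof.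
move=> CF; have Foo := cov0_lty CF; case: CF => QF Fe.
have [tG LM] := tame_seqDU QF Foo; split=> //.
rewrite -lte_fin -NE// EFinD -outer_phi0E.
exact: le_lt_trans (pull_sum_seqDU bijS phi0 QF) Fe.
Qed.

Let tame_ex e : 0 < e -> exists F, [/\ tame Q F, N F < P + e & L F <= M].
Proof.
move=> e0; have fo : outer S A phi0 Q \is a fin_num by rewrite outer_fin.
have [_ [F QF <-] Fe] := lb_ereal_inf_adherent e0 fo.
by exists (seqDU F); apply: (@cov0_seqDU e).
Qed.

Let h_ge0 a F : 0 < a < 1 -> tame Q F -> 0 <= h a F.
Proof. by move=> a01 tF; apply: (tame_ge0 tF (dompw a01)) => x; exact: powR_ge0. Qed.

Let hellinger_fin a : 0 < a < 1 -> hellinger0 phi0 Z a Q \is a fin_num.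
Proof.
move=> a01; rewrite ge0_fin_numE.
  apply: (@le_lt_trans _ _ (P + 1 + M)%:E); last by rewrite ltry.
  apply: lim_inf_over_le; first exact: cov0_nd.
  move=> e e0; have e10 : 0 < Num.min e 1 by rewrite lt_min e0 ltr01.
  have [me m1] : Num.min e 1 <= e /\ Num.min e 1 <= 1 by rewrite !ge_min !lexx orbT.
  have [F [tF NF LF]] := tame_ex e10; exists F.
    by apply/(cov0_tame _ tF); lra.
  rewrite hE// lee_fin; have da := dompw a01.
  have d1 : dominated z (fun x => 1 + 1 * z x) by exact: dominated_lin.
  have : 'I[pw a] F <= 'I[fun x => 1 + 1 * z x] F.
    apply: (tame_le tF da d1) => x; rewrite mul1r.
    by apply: powR_le1D => //; case/andP: a01 => ? ?; rewrite !ltW.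
  by rewrite (tame_lin _ tF dom1 domz) mul1r -/(h a F) -/(N F) -/(L F); lra.
apply: (lim_inf_over_ge cov0_nd ltr01) => F _.
by apply: nneseries_ge0 => n _ _; apply: integral_ge0 => x _; exact: poweR_ge0.
Qed.

Let hellingerE a : 0 < a < 1 -> hellinger0 phi0 Z a Q = (H a)%:E.
Proof. by move=> a01; rewrite fineK// hellinger_fin. Qed.

Let near_tame a k : 0 < a < 1 -> 0 < k ->
  exists F, [/\ tame Q F, N F < P + k, h a F < H a + k & L F <= M].
Proof.
move=> a01 k0.
have Hk : (hellinger0 phi0 Z a Q < (H a + k)%:E)%E.
  by rewrite hellingerE// lte_fin ltrDl.
have [F CF hF] := lim_inf_over_lt cov0_nd Hk k0.
have [tG NG LG] := cov0_seqDU CF; exists (seqDU F); split=> //.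
rewrite -lte_fin -hE// (le_lt_trans _ hF)//.
apply: (seqDU_le (f := pw a)) => //; first by case: CF.
- by move=> x; exact: powR_ge0.
- by move=> B; exact: pow_intE.
Qed.

Let H_low a k : 0 < a < 1 -> 0 < k -> exists2 e, 0 < e &
  forall F, tame Q F -> N F < P + e -> H a - k < h a F.
Proof.
move=> a01 k0.
have Hk : ((H a - k)%:E < hellinger0 phi0 Z a Q)%E.
  by rewrite hellingerE// lte_fin ltrBlDr ltrDl.
have [e e0 eC] := lim_inf_over_gt cov0_nd Hk; exists e => // F tF NF.
by rewrite -lte_fin -hE//; apply: eC; exact/(cov0_tame _ tF).
Qed.

Let H_ge0 a : 0 < a < 1 -> 0 <= H a.
Proof.
move=> a01; apply/ler_addgt0Pr => k k0; have [F [tF _ hF _]] := near_tame a01 k0.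
by have := h_ge0 a01 tF; lra.
Qed.

(* A small weight s on Z^a keeps the cover nearly optimal for phi_0, while an
   error s e in the weighted sum is only an error e in the Z^a-sum. *)
Let H_up a e : 0 < a < 1 -> 0 < e -> exists2 F,
  near_min (tame Q) N h P H a e F & L F < L0 + e.
Proof.
move=> a01 e0; have Ha := H_ge0 a01.
pose s := Num.min 1 (e / 2 / (H a + e)).
have He : 0 < H a + e by rewrite ltr_wpDl.
have s0 : 0 < s by rewrite lt_min ltr01 !divr_gt0.
have sHe : s * (H a + e) <= e / 2.
  by rewrite -ler_pdivlMr// ge_min lexx orbT.
(* [f1] is the density of g = phi_0 + s Z^a phi_0, and [f2] that of m = g + Lambda. *)
pose f1 x : R := 1 + s * pw a x; pose f2 x : R := f1 x + 1 * z x.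
have da := dompw a01.
have d1 : dominated z f1 by exact: dominated_lin.
have d2 : dominated z f2 by exact: dominated_lin.
have pw0 x : 0 <= s * pw a x by rewrite mulr_ge0 ?powR_ge0// ltW.
have f10 x : 0 <= f1 x by rewrite addr_ge0.
have f20 x : 0 <= f2 x by rewrite addr_ge0// mul1r.
have [g gE] := density_measure phi0 d1.1 f10.
have [m mE] := density_measure phi0 d2.1 f20.
have fin_dens (f : T -> R) (k : {measure set T -> \bar R}) : dominated z f ->
    (forall E, k E = \int[phi0]_(x in E) (f x)%:E)%E -> fin_num_fun k.
  move=> df kE B mB; rewrite kE; apply: integrable_fin_num => //.
  exact: (integrable_dominated iz mB df).
have fg := fin_dens _ _ d1 gE; have fm := fin_dens _ _ d2 mE.
have mD B : mA0 B -> (m B = g B + Lambda B)%E.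
  move=> mB; rewrite mE gE LambdaE// -integralD//.
  - by apply: eq_integral => x _; rewrite -EFinD /f2 mul1r.
  - exact: (integrable_dominated iz mB d1).
  - exact: (integrable_dominated iz mB domz).
have := outer_add bijS fg fin_Lambda fm mD invLambda BQ.
have gI F : tame Q F -> pull_sum S g F = (N F + s * h a F)%:E.
  by move=> tF; rewrite (tame_int tF d1 (fun B _ => gE B)) (tame_lin _ tF dom1 da).
have mI F : tame Q F -> pull_sum S m F = (N F + s * h a F + L F)%:E.
  move=> tF; rewrite (tame_int tF d2 (fun B _ => mE B)) (tame_lin _ tF d1 domz).
  by rewrite (tame_lin _ tF dom1 da) mul1r.
have gQ : (outer S A g Q <= (P + s * H a)%:E)%E.
  apply/lee_addgt0Pr => k k0.
  have k1 : 0 < k / (1 + s) by rewrite divr_gt0// addr_gt0.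
  have [F [tF NF hF _]] := near_tame a01 k1.
  rewrite (@le_trans _ _ (pull_sum S g F))//; first by apply: outer_le; case: tF.
  rewrite gI// -EFinD lee_fin.
  have : s * h a F <= s * (H a + k / (1 + s)) by rewrite ler_wpM2l ?ltW.
  have : k / (1 + s) + s * (k / (1 + s)) = k.
    by rewrite -[X in X + _]mul1r -mulrDl mulrC divfK// gt_eqF// addr_gt0.
  by lra.
move=> mQ; have mQfin : outer S A m Q \is a fin_num by rewrite outer_fin.
have se0 : 0 < s * e by rewrite mulr_gt0.
have [_ [F QF <-] Fe] := lb_ereal_inf_adherent se0 mQfin.
have Fe' : (pull_sum S m F < (P + s * H a + L0 + s * e)%:E)%E.
  apply: (lt_le_trans Fe); rewrite [(_ + s * e)%:E]EFinD leeD2r//.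
  by rewrite (le_trans mQ)// EFinD outer_LambdaE leeD2r.
have tF : tame Q F.
  have le_m (f : T -> R) (k : set X -> \bar R) : (forall x, 0 <= f x) -> (forall x, f x <= f2 x) ->
    dominated z f ->
    (forall B, mA0 B -> k B = \int[phi0]_(x in B) (f x)%:E)%E ->
    (pull_sum S k F < +oo)%E.
    move=> f0 ff2 df kE; apply: (@le_lt_trans _ _ (pull_sum S m F)); last first.
      by apply: (lt_trans Fe'); rewrite ltry.
    have [mF _] := (coversP A bijS _ _).1 QF.
    apply: lee_nneseries => [n _ _|n _].
      by rewrite kE//; apply: integral_ge0 => x _; rewrite lee_fin.
    rewrite kE// mE; apply: ge0_le_integral => //.
    - by move=> x _; rewrite lee_fin.
    - by apply: measurable_funTS; apply/measurable_EFinP; case: df.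
    - by apply: measurable_funTS; apply/measurable_EFinP; case: d2.
    - by move=> x _; rewrite lee_fin.
  split=> //.
    apply: (le_m (fun=> 1)) => // x; rewrite /f2 /f1 mul1r.
    by have := pw0 x; have := z_ge0 x; lra.
  apply: (le_m z) => // x; rewrite /f2 mul1r.
  by have := f10 x; lra.
move: Fe'; rewrite mI// lte_fin => Fe'.
(* The weighted total exceeds P + s H a + L0 by less than s e. As N >= P, L >= L0 and h >= 0, the
   excess of N and of L is below s (H a + e) <= e/2, while s h < s (H a + e). *)
have NP := N_ge tF; have LL0 := L_ge tF; have hh := h_ge0 a01 tF.
have sh : 0 <= s * h a F by rewrite mulr_ge0// ltW.
exists F; last by lra.
split=> //; first by lra.
by rewrite -(ltr_pM2l s0) mulrDr; lra.
Qed.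

(** * Slopes along near-minimising covers *)

Let p a := fine (Psi1 phi0 Z a Q).
Let q a := fine (Xi1 phi0 Lambda Z a Q).
Let nm a e F := near_min (tame Q) N h P H a e F.
Let K1 (a : R) : R := a^-1 + (1 - a)^-1.

Let K1_ge0 a : 0 < a < 1 -> 0 <= K1 a.
Proof. by move=> /andP[a0 a1]; rewrite addr_ge0// invr_ge0 ltW// subr_gt0. Qed.

Let cov_a1_nd a e e' : e <= e' -> cov_a1 phi0 Z a Q e `<=` cov_a1 phi0 Z a Q e'.
Proof. by move=> ee'; apply: nearly_optimal_nd => //; exact: cov0_nd. Qed.

Let cov_a1P a e F : 0 < a < 1 -> tame Q F -> cov_a1 phi0 Z a Q e F <-> nm a e F.
Proof.
move=> a01 tF; split.
  move=> [/(cov0_tame _ tF) NF].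
  by rewrite hE// hellingerE// -EFinD lte_fin.
move=> [_ NF hF]; split; first exact/(cov0_tame _ tF).
by rewrite hE// hellingerE// -EFinD lte_fin.
Qed.

(** The covers defining Psi_1 may have infinite Lambda-sum, so their logarithmic sum need not
    converge absolutely. Adding 1/a makes the integrand nonnegative at the cost of a multiple of the
    finite phi_0-sum. *)
Let log_shift a F : 0 < a < 1 -> (forall n, mA0 (pre F n)) ->
  (pull_sum S phi0 F < +oo)%E ->
  (pull_sum S (pow_log_int phi0 Z a) F =
   pull_sum S (fun B => \int[phi0]_(x in (B : set T)) (pwln a x + a^-1 * 1)%:E) F
   - a^-1%:E * pull_sum S phi0 F)%E.
Proof.
move=> a01 mF Noo; have a0 : 0 < a by case/andP: a01.
have dK := dominated_lin a^-1 (dompwln a01) dom1.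
have K0 x : 0 <= pwln a x + a^-1 * 1.
  by have := powR_ln_ge (z_ge0 x) a0; rewrite /pwln; lra.
have Nfin : pull_sum S phi0 F \is a fin_num.
  by rewrite ge0_fin_numE//; exact: pull_sum_ge0.
have k0 n : (0 <= \int[phi0]_(x in pre F n) (pwln a x + a^-1 * 1)%:E)%E.
  by apply: integral_ge0 => x _; rewrite lee_fin.
rewrite /pull_sum -nneseriesZl//.
apply/cvg_lim => //.
rewrite [X in X @ _ --> _](_ : _ = (fun n =>
    \sum_(0 <= i < n) \int[phi0]_(x in pre F i) (pwln a x + a^-1 * 1)%:E -
    \sum_(0 <= i < n) (a^-1%:E * phi0 (pre F i)))%E); last first.
  apply/funext => n.
  have finN i : phi0 (pre F i) \is a fin_num by exact: fin_phi0.
  rewrite -fin_num_sumeN; last by move=> i _; rewrite fin_numM.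
  rewrite -big_split/=; apply: eq_bigr => i _.
  rewrite pow_log_intE//.
  have il := integrable_dominated iz (mF i) (dompwln a01).
  have -> : (\int[phi0]_(x in pre F i) (pwln a x + a^-1 * 1)%:E =
     \int[phi0]_(x in pre F i) ((pwln a x)%:E + (a^-1)%:E * 1%:E))%E by [].
  rewrite integralD//; last first.
    by apply: integrableZl => //; exact: (integrable_dominated iz (mF i) dom1).
  rewrite integralZl//; last exact: (integrable_dominated iz (mF i) dom1).
  by rewrite -phi0E// addeK// fin_numM.
apply: cvgeB.
- by rewrite fin_num_adde_defl// fin_numN nneseriesZl// fin_numM.
- exact: is_cvg_nneseries.
- by apply: is_cvg_nneseries => n _ _; rewrite mule_ge0// lee_fin invr_ge0 ltW.
Qed.

Let log_le a F k : 0 < a < 1 -> tame Q F -> N F + L F <= k -> `|d a F| <= K1 a * k.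
Proof.
move=> a01 tF NLk; apply: (le_trans (tame_log_bound tF a01)).
by rewrite ler_wpM2l// K1_ge0.
Qed.

Let Psi1_fin a : 0 < a < 1 -> Psi1 phi0 Z a Q \is a fin_num.
Proof.
move=> a01; have a0 : 0 < a by case/andP: a01.
have nd := @cov_a1_nd a; rewrite fin_numElt; apply/andP; split.
  apply: (@lt_le_trans _ _ (- (a^-1 * (P + 1)))%:E); first by rewrite ltNyr.
  apply: (lim_inf_over_ge nd ltr01) => F [CF _].
  have Foo := cov0_lty CF; case: CF => QF FP.
  have [mF _] := (coversP A bijS _ _).1 QF.
  rewrite (log_shift a01 mF Foo) EFinN -[leLHS]add0e leeD//.
    apply: nneseries_ge0 => n _ _; apply: integral_ge0 => x _; rewrite lee_fin.
    by have := powR_ln_ge (z_ge0 x) a0; rewrite /pwln; lra.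
  rewrite leeN2 EFinM lee_pmul2l// ?lte_fin ?invr_gt0//.
  by rewrite (le_trans (ltW FP))// outer_phi0E.
apply: (@le_lt_trans _ _ (K1 a * (P + 1 + M))%:E); last by rewrite ltry.
apply: (lim_inf_over_le nd) => e e0.
have e10 : 0 < Num.min e 1 by rewrite lt_min e0 ltr01.
have [me m1] : Num.min e 1 <= e /\ Num.min e 1 <= 1 by rewrite !ge_min !lexx orbT.
have [F [tF NF hF LF]] := near_tame a01 e10; exists F.
  by apply/(cov_a1P _ a01 tF); split=> //; lra.
rewrite dE// lee_fin (le_trans (ler_norm _))// log_le//; lra.
Qed.

Let Psi1E a : 0 < a < 1 -> Psi1 phi0 Z a Q = (p a)%:E.
Proof. by move=> a01; rewrite fineK// Psi1_fin. Qed.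

Let p_low a k : 0 < a < 1 -> 0 < k -> exists2 e, 0 < e &
  forall F, nm a e F -> p a - k < d a F.
Proof.
move=> a01 k0.
have pk : ((p a - k)%:E < Psi1 phi0 Z a Q)%E.
  by rewrite Psi1E// lte_fin ltrBlDr ltrDl.
have [e e0 eC] := lim_inf_over_gt (@cov_a1_nd a) pk; exists e => // F nF.
have tF : tame Q F by case: nF.
by rewrite -lte_fin -dE//; apply: eC; exact/(cov_a1P _ a01 tF).
Qed.

(* Making the cover disjoint can lower the logarithmic sum only up to the mass
   removed, because [z^a ln z + 1/a >= 0]. *)
Let p_up a k e : 0 < a < 1 -> 0 < k -> 0 < e -> exists F,
  [/\ nm a e F, L F <= M & d a F < p a + k].
Proof.
move=> a01 k0 e0; have a0 : 0 < a by case/andP: a01.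
have k20 : 0 < k / 2 by lra.
pose e' := Num.min e (a * (k / 2)).
have e'0 : 0 < e' by rewrite lt_min e0 mulr_gt0.
have [e'e e'k] : e' <= e /\ e' <= a * (k / 2) by rewrite !ge_min !lexx orbT.
have pk : (Psi1 phi0 Z a Q < (p a + k / 2)%:E)%E by rewrite Psi1E// lte_fin ltrDl.
have [F CF dF] := lim_inf_over_lt (@cov_a1_nd a) pk e'0.
have [C0F hF] := CF; have [tG NG LG] := cov0_seqDU C0F.
have Foo := cov0_lty C0F; have [QF FP] := C0F.
have [mF _] := (coversP A bijS _ _).1 QF.
exists (seqDU F); split=> //.
  split=> //; first by lra.
  apply: (@lt_le_trans _ _ (H a + e')); last by lra.
  rewrite -lte_fin -hE// EFinD -hellingerE// (le_lt_trans _ hF)//.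
  apply: (seqDU_le (f := pw a)) => //.
  - by move=> x; exact: powR_ge0.
  - by move=> B; exact: pow_intE.
have dK := dominated_lin a^-1 (dompwln a01) dom1.
have K0 x : 0 <= pwln a x + a^-1 * 1.
  by have := powR_ln_ge (z_ge0 x) a0; rewrite /pwln; lra.
set g := fun B : set X => (\int[phi0]_(x in (B : set T)) (pwln a x + a^-1 * 1)%:E)%E.
have gle : (pull_sum S g (seqDU F) <= pull_sum S g F)%E.
  by apply: (seqDU_le QF dK.1 K0) => B _.
have gG : pull_sum S g (seqDU F) = (d a (seqDU F) + a^-1 * N (seqDU F))%:E.
  by rewrite (tame_int tG dK) // (tame_lin _ tG (dompwln a01) dom1).
have gF : (pull_sum S g F < (p a + k / 2 + a^-1 * (P + e'))%:E)%E.
  move: dF; rewrite (log_shift a01 mF Foo) -/g.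
  have Nfin : (a^-1%:E * pull_sum S phi0 F)%E \is a fin_num.
    by rewrite fin_numM// ge0_fin_numE//; exact: pull_sum_ge0.
  rewrite lteBlDr// => /lt_le_trans; apply.
  rewrite [leRHS]EFinD leeD2l// EFinM lee_pmul2l// ?lte_fin ?invr_gt0//.
  by rewrite EFinD -outer_phi0E ltW.
move: (le_lt_trans gle gF); rewrite gG lte_fin.
have : a^-1 * P <= a^-1 * N (seqDU F) by rewrite ler_wpM2l ?N_ge// invr_ge0 ltW.
have : a^-1 * e' <= k / 2 by rewrite ler_pdivrMl.
lra.
Qed.

(** * Covers that are also nearly optimal for Lambda *)

Let cov1_nd e e' : e <= e' -> cov1 Lambda Q e `<=` cov1 Lambda Q e'.
Proof. by move=> ee'; exact: nearly_optimal_nd. Qed.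

Let half01 : 0 < (2^-1 : R) < 1. Proof. by apply/andP; split; lra. Qed.

Let cov1P e F : tame Q F -> cov1 Lambda Q e F <-> L F < L0 + e.
Proof.
move=> tF; rewrite /cov1 /nearly_optimal /= LE// outer_LambdaE -EFinD lte_fin.
by split=> [[]//|?]; split=> //; case: tF.
Qed.

(** [H_up] supplies covers nearly optimal for phi_0 and Lambda at once; the exponent 1/2 is an
    arbitrary choice. *)
Let Phi_LambdaE : Phi_Lambda phi0 Lambda Q = P%:E.
Proof.
apply/eqP; rewrite eq_le; apply/andP; split.
  apply/lee_addgt0Pr => k k0; apply: (lim_inf_over_le cov1_nd) => e e0.
  have m0 : 0 < Num.min e k by rewrite lt_min e0.
  have [me mk] : Num.min e k <= e /\ Num.min e k <= k by rewrite !ge_min !lexx orbT.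
  have [F [tF NF _] LF] := H_up half01 m0; exists F.
    by apply/(cov1P _ tF); lra.
  rewrite NE// -EFinD lee_fin; lra.
apply: (lim_inf_over_ge cov1_nd ltr01) => F [QF _].
by rewrite -outer_phi0E; exact: outer_le.
Qed.

Let cov01_nd e e' : e <= e' -> cov01 phi0 Lambda Q e `<=` cov01 phi0 Lambda Q e'.
Proof. by move=> ee'; apply: nearly_optimal_nd => //; exact: cov1_nd. Qed.

Let cov01_tame e F : cov01 phi0 Lambda Q e F -> tame Q F.
Proof.
move=> [[QF LF] NF]; split=> //.
- by apply: (lt_trans NF); rewrite Phi_LambdaE -EFinD ltry.
- by apply: (lt_trans LF); rewrite outer_LambdaE -EFinD ltry.
Qed.

Let cov01P e F : tame Q F -> cov01 phi0 Lambda Q e F <-> N F < P + e /\ L F < L0 + e.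
Proof.
move=> tF; split=> [[/(cov1P _ tF) LF]|[NF LF]].
  by rewrite NE// Phi_LambdaE -EFinD lte_fin.
by split; [exact/(cov1P _ tF) | rewrite NE// Phi_LambdaE -EFinD lte_fin].
Qed.

(** Near-optimality for Lambda does not raise the infimum, by [H_up]; it cannot lower it either,
    since the covers remain nearly optimal for phi_0 and [H_low] applies. *)
Let hellinger01E a : 0 < a < 1 -> hellinger01 phi0 Lambda Z a Q = (H a)%:E.
Proof.
move=> a01; apply/eqP; rewrite eq_le; apply/andP; split.
  apply/lee_addgt0Pr => k k0; apply: (lim_inf_over_le cov01_nd) => e e0.
  have m0 : 0 < Num.min e k by rewrite lt_min e0.
  have [me mk] : Num.min e k <= e /\ Num.min e k <= k by rewrite !ge_min !lexx orbT.
  have [F [tF NF hF] LF] := H_up a01 m0; exists F.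
    by apply/(cov01P _ tF); split; lra.
  rewrite hE// -EFinD lee_fin; lra.
apply/lee_addgt0Pr => k k0; rewrite -leeBlDr// -EFinB.
have [e e0 He] := H_low a01 k0.
apply: (lim_inf_over_ge cov01_nd e0) => F CF; have tF := cov01_tame CF.
have [NF _] := (cov01P _ tF).1 CF.
by rewrite hE// lee_fin ltW// He.
Qed.

Let cov_a01_nd a e e' : e <= e' ->
  cov_a01 phi0 Lambda Z a Q e `<=` cov_a01 phi0 Lambda Z a Q e'.
Proof. by move=> ee'; apply: nearly_optimal_nd => //; exact: cov01_nd. Qed.

Let cov_a01P a e F : 0 < a < 1 ->
  cov_a01 phi0 Lambda Z a Q e F <-> nm a e F /\ L F < L0 + e.
Proof.
move=> a01; split=> [[CF]|[[tF NF hF] LF]].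
  have tF := cov01_tame CF; have [NF LF] := (cov01P _ tF).1 CF.
  by rewrite hE// hellinger01E// -EFinD lte_fin => hF; split.
split; first by apply/(cov01P _ tF).
by rewrite hE// hellinger01E// -EFinD lte_fin.
Qed.

Let Xi1_fin a : 0 < a < 1 -> Xi1 phi0 Lambda Z a Q \is a fin_num.
Proof.
move=> a01; have nd := @cov_a01_nd a; rewrite fin_numElt; apply/andP; split.
  apply: (@lt_le_trans _ _ (- (K1 a * (P + 1 + (L0 + 1))))%:E); first by rewrite ltNyr.
  apply: (lim_sup_over_ge nd) => e e0.
  have e10 : 0 < Num.min e 1 by rewrite lt_min e0 ltr01.
  have [me m1] : Num.min e 1 <= e /\ Num.min e 1 <= 1 by rewrite !ge_min !lexx orbT.
  have [F [tF NF hF] LF] := H_up a01 e10; exists F.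
    by apply/(cov_a01P _ _ a01); split; [split=> //|]; lra.
  have NL : N F + L F <= P + 1 + (L0 + 1) by lra.
  have := log_le a01 tF NL.
  by rewrite dE// lee_fin ler_norml => /andP[].
apply: (@le_lt_trans _ _ (K1 a * (P + 1 + (L0 + 1)))%:E); last by rewrite ltry.
apply: (lim_sup_over_le nd ltr01) => F /(cov_a01P _ _ a01)[[tF NF hF] LF].
by rewrite dE// lee_fin (le_trans (ler_norm _))// log_le//; lra.
Qed.

Let Xi1E a : 0 < a < 1 -> Xi1 phi0 Lambda Z a Q = (q a)%:E.
Proof. by move=> a01; rewrite fineK// Xi1_fin. Qed.

Let q_up a k : 0 < a < 1 -> 0 < k -> exists2 e, 0 < e &
  forall F, nm a e F -> L F < L0 + e -> d a F < q a + k.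
Proof.
move=> a01 k0.
have qk : (Xi1 phi0 Lambda Z a Q < (q a + k)%:E)%E by rewrite Xi1E// lte_fin ltrDl.
have [e e0 eC] := lim_sup_over_lt (@cov_a01_nd a) qk; exists e => // F nF LF.
have tF : tame Q F by case: nF.
by rewrite -lte_fin -dE//; apply: eC; exact/(cov_a01P _ _ a01).
Qed.

Let q_low a k e : 0 < a < 1 -> 0 < k -> 0 < e -> exists F,
  [/\ nm a e F, L F < L0 + e & q a - k < d a F].
Proof.
move=> a01 k0 e0.
have qk : ((q a - k)%:E < Xi1 phi0 Lambda Z a Q)%E.
  by rewrite Xi1E// lte_fin ltrBlDr ltrDl.
have [F /(cov_a01P _ _ a01)[nF LF] dF] := lim_sup_over_gt (@cov_a01_nd a) qk e0.
have tF : tame Q F by case: nF.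
by exists F; split=> //; rewrite -lte_fin -dE.
Qed.

Let HQE : HQ phi0 Lambda Z Q = [set a | 0 < a < 1 /\ p a < q a].
Proof.
apply/seteqP; split=> a [a01 pq]; split=> //.
  by rewrite -lte_fin -Psi1E// -Xi1E.
by rewrite Psi1E// Xi1E// lte_fin.
Qed.

Let K (e : R) : R := 16 / e ^+ 2.

Let K_ge0 e : 0 < e -> 0 <= K e.
Proof. by move=> e0; rewrite divr_ge0// sqr_ge0. Qed.

Let N_ge0 F : tame Q F -> 0 <= N F.
Proof. by move=> tF; exact: (tame_ge0 tF dom1). Qed.

Let L_ge0 F : tame Q F -> 0 <= L F.
Proof. by move=> tF; exact: (tame_ge0 tF domz). Qed.

Let convex F a b := @tame_convex Q F a b.
Let semiconcave F e a b := @tame_semiconcave Q F e a b.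
Let bound F a := @tame_log_bound Q F a.

Lemma hellinger0_fin_num a : 0 < a < 1 -> hellinger0 phi0 Z a Q \is a fin_num.
Proof. exact: hellinger_fin. Qed.

Lemma countable_HQ : countable (HQ phi0 Lambda Z Q).
Proof.
rewrite HQE; exact: (countable_value_jumps K_ge0 semiconcave H_low p_low p_up
  q_up q_low).
Qed.

Lemma hellinger0_C1 (E := [set b : R | 0 < b < 1] `\` HQ phi0 Lambda Z Q) :
  (forall a, E a -> derivable (fun b => fine (hellinger0 phi0 Z b Q)) a 1) /\
  {within E, continuous (derive1 (fun b => fine (hellinger0 phi0 Z b Q)))}.
Proof.
have EP a : E a -> 0 < a < 1 /\ q a <= p a.
  move=> [a01 aH]; split=> //; rewrite leNgt; apply/negP => pq; apply: aH.
  by rewrite HQE.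
exact: (value_C1 K_ge0 N_ge0 L_ge0 convex semiconcave
  bound H_low H_up p_low p_up q_up EP).
Qed.
End near_optimal_covers.

Theorem corollary6 (R : realType) (X : pointedType) (S : X -> X)
    (A : set (set X))
    (phi0 Lambda : {finite_measure set (A0T S A) -> \bar R})
    (Z : A0T S A -> \bar R)
    (bijS : bijective S)
    (sigmaA : sigma_algebra setT A)
    (invLambda : forall B : set X, A0 S A B -> Lambda (S @^-1` B) = Lambda B)
    (Lambda_phi0 : Lambda `<< phi0)
    (Z_ge0 : forall x, (0 <= Z x)%E)
    (mZ : measurable_fun setT Z)
    (Z_density : forall B : set (A0T S A), A0 S A B ->
       Lambda B = (\int[phi0]_(x in B) Z x)%E) :
  countable (HQ phi0 Lambda Z setT) /\
  forall Q : set X, Bfull S A Q ->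
    [/\ forall a : R, 0 < a < 1 -> hellinger0 phi0 Z a Q \is a fin_num,
        forall a : R, ([set b | 0 < b < 1] `\` HQ phi0 Lambda Z Q) a ->
          derivable (fun b : R => fine (hellinger0 phi0 Z b Q)) a 1 &
        {within [set b | 0 < b < 1] `\` HQ phi0 Lambda Z Q, continuous
          (derive1 (fun b : R => fine (hellinger0 phi0 Z b Q)))}].
Proof.
have BT : Bfull S A setT.
  exact: (@measurableT _ (g_sigma_algebraType (all_time_sets S A))).
split; first exact: (countable_HQ bijS invLambda Z_ge0 mZ Z_density BT).
move=> Q BQ.
have [dH cH] := hellinger0_C1 bijS invLambda Z_ge0 mZ Z_density BQ.
split=> // a a01.
exact: (hellinger0_fin_num bijS invLambda Z_ge0 mZ Z_density Q a01).
Qed.
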